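(* Consider the following decision problem. Input: an annotated acyclic structured process model $(P,\mathrm{ann})$ and a finite set $\mathcal{R}$ of conditional obligations (each of achievement or maintenance type) whose requirement, trigger and deadline are propositional literals, such that for every obligation $\langle o,r,t,d\rangle\in\mathcal{R}$ the $\mathsf{start}$ task satisfies $\neg r\in\mathrm{ann}(\mathsf{start})$ and the $\mathsf{end}$ task satisfies $d\in\mathrm{ann}(\mathsf{end})$. Question: is $(P,\mathrm{ann})$ fully compliant with $\mathcal{R}$, i.e. does every trace of $(P,\mathrm{ann})$ comply with every obligation in $\mathcal{R}$? This problem belongs to the complexity class $\mathbf{P}$: it can be decided in time polynomial in the size of the process model and the cardinality of $\mathcal{R}$.
   Context: Process blocks are defined inductively: a single task is a process block; if $B_1,\dots,B_n$ ($n>1$) are process blocks with pairwise disjoint sets of tasks, then $\mathsf{SEQ}(B_1,\dots,B_n)$, $\mathsf{XOR}(B_1,\dots,B_n)$ and $\mathsf{AND}(B_1,\dots,B_n)$ are process blocks. A structured process model $P$ is a process block $\mathsf{SEQ}(\mathsf{start},B,\mathsf{end})$, where $\mathsf{start}$ and $\mathsf{end}$ are tasks and $B$ is a process block. Executions. The set $\Sigma(B)$ of executions of a block $B$ is a set of finite sequences of tasks: if $B$ is a task $s$, then $\Sigma(B)=\{(s)\}$; $\Sigma(\mathsf{SEQ}(B_1,\dots,B_n))$ is the set of all concatenations $\epsilon_1\cdots\epsilon_n$ with $\epsilon_i\in\Sigma(B_i)$; $\Sigma(\mathsf{XOR}(B_1,\dots,B_n))=\bigcup_i\Sigma(B_i)$;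 $\Sigma(\mathsf{AND}(B_1,\dots,B_n))$ is the set of all interleavings of sequences $\epsilon_1,\dots,\epsilon_n$ with $\epsilon_i\in\Sigma(B_i)$ (all linear orders on the disjoint union of their tasks that extend the order of each $\epsilon_i$). Annotations and traces. A literal is a propositional atom or its negation; $\neg l$ denotes the complement of the literal $l$ (with $\neg\neg l=l$). A set of literals is consistent if it contains no complementary pair. An annotation $\mathrm{ann}$ assigns to each task a consistent set of literals. For consistent sets of literals, $L_1\oplus L_2=(L_1\setminus\{\neg l: l\in L_2\})\cup L_2$. The trace of an execution $(t_1,\dots,t_n)$ is the sequence of states $(\sigma_1,\dots,\sigma_n)$ where $\sigma_0=\emptyset$ and $\sigma_{i}=\sigma_{i-1}\oplus\mathrm{ann}(t_{i})$ for $1\le i\le n$. The traces of $(P,\mathrm{ann})$ are the traces of the executions in $\Sigma(P)$. Obligations. A conditional obligation is a tuple $\langle o,r,t,d\rangle$ with type $o\in\{a,m\}$ (achievement or maintenance) and literals $r$ (requirement), $t$ (trigger), $d$ (deadline). A trace $(\sigma_1,\dots,\sigma_n)$ of an execution $(t_1,\dots,t_n)$ complies with the achievement obligation $\langle a,r,t,d\rangle$ iff for every $i$ with $t\in\mathrm{ann}(t_i)$ there is $j\ge i$ with $r\in\sigma_j$ such that there is no $k$ with $i\le k<j$ and $d\in\sigma_k$. It complies with the maintenance obligation $\langle m,r,t,d\rangle$ iff for every $i$ with $t\in\mathrm{ann}(t_i)$ there is $j\ge i$ with $d\in\sigma_j$ and $r\in\sigma_k$ for all $i\le k\le j$. *)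

(* Defs.v *)
From HB Require Import structures.
From mathcomp Require Import all_boot all_order all_algebra.

Set Implicit Arguments.
Unset Strict Implicit.
Unset Printing Implicit Defensive.

(** * Process models *)

(* Tasks and propositional atoms are named by bit strings, so that the
   length of an encoded instance accounts for the names it contains. *)
Definition name := seq bool.
Definition task := name.

Inductive operator := SEQ | XOR | AND.

Inductive block := Task of task | Node of operator & seq block.

Fixpoint tasks (B : block) : seq task :=
  match B with
  | Task s => [:: s]
  | Node _ Bs => flatten (map tasks Bs)
  end.

Definition disjoint_tasks (B1 B2 : block) : bool :=
  ~~ has [in tasks B1] (tasks B2).

Fixpoint process_block (B : block) : bool :=
  match B with
  | Task _ => true
  | Node _ Bs =>
      [&& 1 < size Bs, all process_block Bs & pairwise disjoint_tasks Bs]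
  end.

Record model := Model { start : task; body : block; finish : task }.

Definition model_block (P : model) : block :=
  Node SEQ [:: Task (start P); body P; Task (finish P)].

(** * Executions *)

Definition choices T (Es : seq (seq T)) : seq (seq T) :=
  foldr (fun E Fs => [seq e :: f | e <- E, f <- Fs]) [:: [::]] Es.

(* Arrangements of all the entries of the sequences in [es] of which every
   member of [es] is a subsequence; these are the interleavings when, as in a
   process block, no entry is repeated. *)
Definition interleavings (T : eqType) (es : seq (seq T)) : seq (seq T) :=
  [seq w <- permutations (flatten es) | all (fun e => subseq e w) es].

Fixpoint executions (B : block) : seq (seq task) :=
  match B with
  | Task s => [:: [:: s]]
  | Node SEQ Bs => [seq flatten es | es <- choices (map executions Bs)]
  | Node XOR Bs => flatten (map executions Bs)
  | Node AND Bs =>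
      flatten [seq interleavings es | es <- choices (map executions Bs)]
  end.

(** * Annotations, traces *)

(* [(true, x)] is the atom [x] and [(false, x)] its negation. *)
Definition literal := (bool * name)%type.
Definition compl (l : literal) : literal := (~~ l.1, l.2).

(* Finite sets of literals are represented by lists, of which only membership
   matters. *)
Definition consistent (L : seq literal) : bool :=
  all (fun l => compl l \notin L) L.

Definition annotation := task -> seq literal.

Definition oplus (L1 L2 : seq literal) : seq literal :=
  [seq l <- L1 | l \notin map compl L2] ++ L2.

(* For e = (t_1, .., t_n) this is the list (sigma_1, .., sigma_n), without
   the initial state sigma_0 = [::]. *)
Definition trace (ann : annotation) (e : seq task) : seq (seq literal) :=
  scanl oplus [::] (map ann e).

(** * Obligations *)

Inductive kind := Achievement | Maintenance.

Record obligation := Obligation {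
  type_of : kind;
  requirement : literal;
  trigger : literal;
  deadline : literal }.

Definition is_achievement (k : kind) : bool :=
  if k is Achievement then true else false.

Fact is_achievementK :
  cancel is_achievement (fun b => if b then Achievement else Maintenance).
Proof. by case. Qed.

HB.instance Definition _ := Equality.copy kind (can_type is_achievementK).

Fact obligation_tupleK :
  cancel (fun o => (type_of o, requirement o, trigger o, deadline o))
         (fun u => let: (k, r, t, d) := u in Obligation k r t d).
Proof. by case. Qed.

HB.instance Definition _ := Equality.copy obligation (can_type obligation_tupleK).

Definition complies (ann : annotation) (e : seq task) (o : obligation) : Prop :=
  let sigma := nth [::] (trace ann e) in
  forall i, i < size e -> trigger o \in ann (nth [::] e i) ->
  match type_of o with
  | Achievement =>
      exists j, [/\ i <= j < size e, requirement o \in sigma j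
                  & ~ exists k, i <= k < j /\ deadline o \in sigma k]
  | Maintenance =>
      exists j, [/\ i <= j < size e, deadline o \in sigma j
                  & forall k, i <= k <= j -> requirement o \in sigma k]
  end.

(** * Instances of the compliance problem *)

(* The values of [ann] outside the tasks of the model are irrelevant; they do
   not occur in the encoding below. *)
Record instance := Instance {
  process : model;
  ann : annotation;
  obligations : seq obligation }.

Definition admissible (I : instance) : Prop :=
  let P := process I in
  [/\ process_block (model_block P),
      (forall s, s \in tasks (model_block P) -> consistent (ann I s))
    & forall o, o \in obligations I ->
        compl (requirement o) \in ann I (start P) /\
        deadline o \in ann I (finish P)].

Definition fully_compliant (I : instance) : Prop :=
  forall e, e \in executions (model_block (process I)) ->
  forall o, o \in obligations I -> complies (ann I) e o.

(** * Encoding of instances as words *)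

Inductive symbol :=
  | Bit of bool        (* a bit of a name *)
  | Sign of bool       (* opens a literal *)
  | Leaf               (* opens a task *)
  | Open of operator   (* opens a composite block *)
  | Oblig of kind      (* opens an obligation *)
  | Close.

Definition symbols : seq symbol :=
  [:: Bit false; Bit true; Sign false; Sign true; Leaf;
      Open SEQ; Open XOR; Open AND;
      Oblig Achievement; Oblig Maintenance; Close].

Definition symbol_index (a : symbol) : nat :=
  match a with
  | Bit b => b
  | Sign b => 2 + b
  | Leaf => 4
  | Open SEQ => 5 | Open XOR => 6 | Open AND => 7
  | Oblig Achievement => 8 | Oblig Maintenance => 9
  | Close => 10
  end.

Fact symbol_indexK : cancel symbol_index (nth Close symbols).
Proof. by case=> // [] []. Qed.

HB.instance Definition _ := Countable.copy symbol (can_type symbol_indexK).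

Fact symbols_enumP : Finite.axiom symbols.
Proof. by case=> // [] []. Qed.

HB.instance Definition _ := isFinite.Build symbol symbols_enumP.

Definition encode_name (x : name) : seq symbol := rcons (map Bit x) Close.

Definition encode_literal (l : literal) : seq symbol :=
  Sign l.1 :: encode_name l.2.

Fixpoint encode_block (ann : annotation) (B : block) : seq symbol :=
  match B with
  | Task s =>
      Leaf :: encode_name s ++
      rcons (flatten (map encode_literal (ann s))) Close
  | Node op Bs => Open op :: rcons (flatten (map (encode_block ann) Bs)) Close
  end.

Definition encode_obligation (o : obligation) : seq symbol :=
  Oblig (type_of o) :: encode_literal (requirement o) ++
  encode_literal (trigger o) ++ encode_literal (deadline o).

Definition encode (I : instance) : seq symbol :=
  encode_block (ann I) (model_block (process I)) ++
  flatten (map encode_obligation (obligations I)).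

Lemma block_rect_nested (Q : block -> Prop) :
    (forall s, Q (Task s)) ->
    (forall op Bs, foldr (fun B => and (Q B)) True Bs -> Q (Node op Bs)) ->
  forall B, Q B.
Proof.
move=> QT QN; fix IH 1 => -[s|op Bs]; first exact: QT.
by apply: QN; elim: Bs => //= B Bs IHBs; split.
Qed.

Lemma encode_name_inj x y u v :
  encode_name x ++ u = encode_name y ++ v -> x = y /\ u = v.
Proof.
elim: x y => [|b x IH] [|c y] //=; first by case.
by case=> -> /IH[-> ->].
Qed.

Lemma encode_literal_inj l m u v :
  encode_literal l ++ u = encode_literal m ++ v -> l = m /\ u = v.
Proof.
by case: l m => [b x] [c y]; case=> -> /encode_name_inj[/= -> ->].
Qed.

Lemma encode_literals_inj L M u v :
  rcons (flatten (map encode_literal L)) Close ++ u =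
  rcons (flatten (map encode_literal M)) Close ++ v -> L = M /\ u = v.
Proof.
rewrite !cat_rcons; elim: L M => [|l L IH] [|m M] //=; first by case.
by rewrite -!catA => /encode_literal_inj[-> /IH[-> ->]].
Qed.

Lemma encode_obligation_inj o o' u v :
  encode_obligation o ++ u = encode_obligation o' ++ v -> o = o' /\ u = v.
Proof.
case: o o' => [k r t d] [k' r' t' d'].
have catE a x y z w : (a :: x ++ y ++ z) ++ w = a :: (x ++ (y ++ (z ++ w))).
  by rewrite /= -!catA.
rewrite /encode_obligation !catE => /(congr1 (fun s => (ohead s, behead s))).
move=> /= E; have [/= Ek {}E] := (congr1 fst E, congr1 snd E); case: Ek => ->.
have [-> {}E] := encode_literal_inj E; have [-> {}E] := encode_literal_inj E.
by have [-> ->] := encode_literal_inj E.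
Qed.

Lemma encode_block_inj a b B C u v :
  encode_block a B ++ u = encode_block b C ++ v ->
  [/\ B = C, {in tasks B, a =1 b} & u = v].
Proof.
elim/block_rect_nested: B C u v => [s|op Bs IH] [t|op' Cs] u v //=.
  rewrite -!catA => -[] /encode_name_inj[<- /encode_literals_inj[eqL ->]].
  by split=> // x; rewrite inE => /eqP->.
rewrite !cat_rcons => -[<-] E.
suff [-> eqab ->] : [/\ Bs = Cs, {in flatten (map tasks Bs), a =1 b} & u = v].
  by split.
elim: Bs Cs IH E => [|B Bs IHBs] [|D Cs] /=.
- by move=> _ [->].
- by move=> _; case: D.
- by move=> _; case: B.
case=> IHB IH; rewrite -!catA => /IHB[<- eqB /(IHBs _ IH)[<- eqBs <-]].
by split=> // x; rewrite mem_cat => /orP[/eqB|/eqBs].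
Qed.

(* Hence a word encodes at most one instance, up to the values of the
   annotation outside the tasks of the model. *)
Lemma encode_inj I J : encode I = encode J ->
  [/\ process I = process J,
      {in tasks (model_block (process I)), ann I =1 ann J}
    & obligations I = obligations J].
Proof.
case: I J => [[s B f] a R] [[s' B' f'] a' R'] /encode_block_inj[/=] [-> -> ->].
move=> eqa eqR; split=> //; elim: R R' eqR => [|o R IH] [|o' R'] //=.
by case/encode_obligation_inj=> -> /IH->.
Qed.

(** * The class P *)

(* A multitape deterministic Turing machine with input alphabet [A]: the tapes
   are infinite in both directions, a tape cell contains an input symbol, an
   auxiliary symbol or the blank [None], and [verdict] is defined exactly on
   the halting states. *)
Section Machines.
Variable A : finType.

Inductive direction := Left | Stay | Right.

Record machine := Machine {
  extra_tapes : nat;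
  auxiliary : finType;
  state : finType;
  initial : state;
  verdict : state -> option bool;
  transition :
    state -> {ffun 'I_extra_tapes.+1 -> option (A + auxiliary)} ->
    state * {ffun 'I_extra_tapes.+1 -> option (A + auxiliary) * direction} }.

Definition cell (M : machine) := option (A + auxiliary M).

(* All the cells outside [before] (listed from the head outwards), [scanned]
   and [after] are blank. *)
Record tape (M : machine) := Tape {
  before : seq (cell M);
  scanned : cell M;
  after : seq (cell M) }.

Definition act (M : machine) (T : tape M) (wd : cell M * direction) : tape M :=
  let: Tape l _ r := T in let: (x, d) := wd in
  match d with
  | Left => Tape (behead l) (head None l) (x :: r)
  | Stay => Tape l x r
  | Right => Tape (x :: l) (head None r) (behead r)
  end.

Record configuration (M : machine) := Configuration {
  control : state M;
  memory : {ffun 'I_(extra_tapes M).+1 -> tape M} }.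

Definition step (M : machine) (c : configuration M) : configuration M :=
  if verdict (control c) is Some _ then c else
  let: (q, wd) := transition (control c) [ffun i => scanned (memory c i)] in
  Configuration q [ffun i => act (memory c i) (wd i)].

Definition input_tape (M : machine) (w : seq A) : tape M :=
  let cells := [seq Some (inl a) | a <- w] in
  Tape [::] (head None cells) (behead cells).

Definition blank_tape (M : machine) : tape M := Tape [::] None [::].

Definition start_configuration (M : machine) (w : seq A) : configuration M :=
  Configuration (initial M)
    [ffun i => if i == ord0 then input_tape M w else blank_tape M].

Definition halts_with (M : machine) (w : seq A) (n : nat) (b : bool) : Prop :=
  verdict (control (iter n (@step M) (start_configuration M w))) = Some b.

Definition class_P (L : seq A -> Prop) : Prop :=
  exists (M : machine) (p : {poly nat}), forall w : seq A,
  exists n b, [/\ n <= (p.[size w])%R, halts_with M w n b & b <-> L w].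

End Machines.

(* The language of a decision problem: the encodings of its yes-instances. *)
Definition language (A X : Type) (enc : X -> seq A) (valid yes : X -> Prop) :
    seq A -> Prop :=
  fun w => exists x, [/\ w = enc x, valid x & yes x].

(* Main.v *)
(* A violation of an obligation by an execution has one of six shapes: since the
   requirement is false after the start task and the deadline true after the end
   task, whether a literal holds in a state only depends on the last task that
   sets its atom, so that a violation amounts to cutting the execution into a
   bounded number of consecutive segments which forbid some annotations, one
   segment being the triggering task alone and two more annotations being required
   somewhere. For a block, consider the set of all (pattern, first segment, last
   segment, requirements met) realised by its executions. This set ranges over a
   fixed finite type and is determined by the sets of the components: a SEQ block
   composes intervals of segments, an XOR block takes unions, and an AND block
   combines arbitrary labelled executions over the same interval, because a stable
   sort by segment interleaves them. Hence compliance with one obligation is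
   decided by one bottom-up evaluation of the process tree.

   This evaluation is done during a right-to-left shift-reduce parse of the input
   word. That such folds run in polynomial time is shown for functions on binary
   trees, serialised on the stacks of structured stack programs, and a multitape
   machine simulates a stack program with two steps per instruction. *)

(* The obstacle is AND: its interleavings are exponentially many, and a state depends on the order
   of all components. A labelling of tasks by segments removes it. What a segment forbids concerns
   each task alone, and monotonicity is all that a label asks of the order, so parallel components
   only have to agree on the pattern and on the interval. Occurrences required somewhere are not
   local; they are recorded by weights in a finite commutative monoid, whose absorbing element
   [None] also excludes a second trigger. The number seven comes from six boundaries: the starts of
   two stretches before the trigger, both sides of the trigger, and the ends of two stretches after
   it. On the machine side, folds do not preserve polynomial time in general. They do when each step
   enlarges the accumulator by an amount that does not depend on the accumulator; the parser has
   this property because it stores attributes of bounded size instead of blocks. Since the machine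
   also receives words that encode nothing, the parser must be sound as well as complete. *)
From HB Require Import structures.
From Stdlib Require Import FunctionalExtensionality.
From mathcomp Require Import all_boot all_order all_algebra zify.
Require Import Defs.

Set Implicit Arguments.
Unset Strict Implicit.
Unset Printing Implicit Defensive.

(** * Stack programs and their simulation by Turing machines *)

Definition store (G : Type) := nat -> seq G.

Definition upd G (s : store G) i l : store G := fun j => if j == i then l else s j.

Definition top G (t : pred G) (l : seq G) : bool := if l is x :: _ then t x else false.

Inductive cmd (G : Type) :=
  | Push of nat & G
  | Pop of nat
  | Copy of nat & nat
  | Seq of cmd G & cmd G
  | If of nat & pred G & cmd G & cmd G
  | While of nat & pred G & cmd G.

Arguments Pop {G}.
Arguments Copy {G}.

(** The two extra units of [If] and of a completed round of [While] pay for the branch and the jump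
    of the compiled code. [Copy] from an empty stack has no run, whereas [Pop] leaves it empty. *)
Inductive run (G : Type) : cmd G -> store G -> nat -> store G -> Prop :=
  | run_push i x s : run (Push i x) s 1 (upd s i (x :: s i))
  | run_pop i s : run (Pop i) s 1 (upd s i (behead (s i)))
  | run_copy i j s x l : i != j -> s i = x :: l ->
      run (Copy i j) s 1 (upd s j (x :: s j))
  | run_seq c1 c2 s s1 s2 n1 n2 : run c1 s n1 s1 -> run c2 s1 n2 s2 ->
      run (Seq c1 c2) s (n1 + n2) s2
  | run_if i t c1 c2 s s' n : run (if top t (s i) then c1 else c2) s n s' ->
      run (If i t c1 c2) s n.+2 s'
  | run_while_false i t c s : top t (s i) = false -> run (While i t c) s 1 s
  | run_while_true i t c s s1 s2 n1 n2 : top t (s i) -> run c s n1 s1 ->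
      run (While i t c) s1 n2 s2 -> run (While i t c) s (n1 + n2).+2 s2.

Fixpoint registers G (c : cmd G) : nat :=
  match c with
  | Push i _ | Pop i => i
  | Copy i j => maxn i j
  | Seq c1 c2 => maxn (registers c1) (registers c2)
  | If i _ c1 c2 => maxn i (maxn (registers c1) (registers c2))
  | While i _ c => maxn i (registers c)
  end.

Inductive instr (G : Type) :=
  | IPush of nat & G
  | IPop of nat
  | ICopy of nat & nat
  | IBranch of nat & pred G & nat
  | IJump of nat.

Arguments IPop {G}.
Arguments ICopy {G}.
Arguments IJump {G}.

Fixpoint code_size G (c : cmd G) : nat :=
  match c with
  | Push _ _ | Pop _ | Copy _ _ => 1
  | Seq c1 c2 => code_size c1 + code_size c2
  | If _ _ c1 c2 => (code_size c1 + code_size c2).+2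
  | While _ _ c => (code_size c).+2
  end.

(** [l] is the address of the first instruction. Targets are absolute, and [IBranch] jumps when its
    test fails. *)
Fixpoint compile G (l : nat) (c : cmd G) : seq (instr G) :=
  match c with
  | Push i x => [:: IPush i x]
  | Pop i => [:: IPop i]
  | Copy i j => [:: ICopy i j]
  | Seq c1 c2 => compile l c1 ++ compile (l + code_size c1) c2
  | If i t c1 c2 =>
      IBranch i t (l + code_size c1).+2 ::
      compile l.+1 c1 ++ IJump (l + code_size c1 + code_size c2).+2 ::
      compile (l + code_size c1).+2 c2
  | While i t c =>
      IBranch i t (l + code_size c).+2 :: compile l.+1 c ++ [:: IJump l]
  end.

Lemma size_compile G l (c : cmd G) : size (compile l c) = code_size c.
Proof.
elim: c l => //= [c1 IH1 c2 IH2|i t c1 IH1 c2 IH2|i t c IH] l.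
- by rewrite size_cat IH1 IH2.
- by rewrite size_cat /= IH1 IH2 addnS.
- by rewrite size_cat /= IH addn1.
Qed.

(** * Compiled code on a multitape machine, one tape per stack *)

Section Simulation.
Variables (A : finType) (K : nat) (code : seq (instr (A + bool))).
Notation G := (A + bool)%type.
Notation cel := (option G).

(** The extra address [size code] is the exit; [inr b] is the halting state with verdict [b]. *)
Definition ctrl := ('I_(size code).+1 * bool + bool)%type.

(* Pushing takes two steps: the head first moves left, then writes; the boolean
   of the control state distinguishes them. *)
Definition vm_transition (q : ctrl) (r : {ffun 'I_K.+1 -> cel}) :
    ctrl * {ffun 'I_K.+1 -> cel * direction} :=
  let stay := [ffun j => (r j, Stay)] in
  let on i wd := [ffun j => if j == inord i then wd else (r j, Stay)] in
  match q with
  | inr b => (q, stay)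
  | inl (pc, ph) =>
    if pc == size code :> nat then (inr (r ord0 == Some (inr true)), stay) else
    let next : ctrl := inl (inord pc.+1, false) in
    match nth (IJump 0) code pc with
    | IPush i x =>
        if ph then (next, on i (Some x, Stay))
        else (inl (pc, true), on i (r (inord i), Left))
    | ICopy i j =>
        if ph then (next, on j (r (inord i), Stay))
        else (inl (pc, true), on j (r (inord j), Left))
    | IPop i => (next, on i (None, Right))
    | IBranch i t l =>
        (if oapp t false (r (inord i)) then next else inl (inord l, false), stay)
    | IJump l => (inl (inord l, false), stay)
    end
  end.

Definition vm : machine A := @Machine A K bool ctrl (inl (ord0, false))
  (fun q => if q is inr b then Some b else None) vm_transition.

(** The head is on the top of the stack. Nothing is asked of the cells to its left, as a push
    overwrites them, and comparing by [nth] ignores trailing blanks. *)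
Definition holds (T : tape vm) (l : seq G) : Prop :=
  forall n, nth None (scanned T :: after T) n = nth None (map Some l) n.

Definition represents (c : configuration vm) (pc : nat) (s : store G) : Prop :=
  control c = inl (inord pc, false) /\
  forall i, i <= K -> holds (memory c (inord i)) (s i).

Definition reaches (pc : nat) (s : store G) (n : nat) (pc' : nat) (s' : store G) : Prop :=
  forall c, represents c pc s ->
  exists2 m, m <= n & represents (iter m (@step A vm) c) pc' s'.

Lemma reaches_trans pc1 s1 n pc2 s2 m pc3 s3 :
  reaches pc1 s1 n pc2 s2 -> reaches pc2 s2 m pc3 s3 ->
  reaches pc1 s1 (n + m) pc3 s3.
Proof.
move=> H1 H2 c /H1[a le_a /H2[b le_b Hb]].
by exists (b + a); rewrite ?iterD // addnC leq_add.
Qed.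

Lemma reaches_leq pc s n m pc' s' :
  n <= m -> reaches pc s n pc' s' -> reaches pc s m pc' s'.
Proof. by move=> le_nm H c /H[k le_kn Hk]; exists k => //; apply: leq_trans le_nm. Qed.

Lemma holds_stay T l : holds T l -> holds (act T (scanned T, Stay)) l.
Proof. by case: T. Qed.

Lemma holds_top T l : holds T l -> scanned T = ohead l.
Proof. by move/(_ 0) => /= ->; case: l. Qed.

Lemma holds_pop T l : holds T l -> holds (act T (None, Right)) (behead l).
Proof.
case: T => b x a H n; rewrite /holds /= in H *.
have -> : nth None (head None a :: behead a) n = nth None (x :: a) n.+1.
  by case: (a) => //=; case: n => //= n; rewrite nth_nil.
by rewrite H; case: (l) => //=; rewrite nth_nil.
Qed.

Lemma holds_push T l x :
  holds T l -> holds (act (act T (scanned T, Left)) (Some x, Stay)) (x :: l).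
Proof. by case: T => b z a H [|n] //=; apply: H. Qed.

Lemma step_vm (c : configuration vm) pc ph : control c = inl (pc, ph) ->
  @step A vm c =
    let r := [ffun i => scanned (memory c i)] in
    @Configuration A vm (vm_transition (inl (pc, ph)) r).1
      [ffun i => act (memory c i) ((vm_transition (inl (pc, ph)) r).2 i)].
Proof. by move=> E; rewrite /step E [transition _ _]surjective_pairing. Qed.

Lemma inord_inj i j : i <= K -> j <= K -> (inord i == inord j :> 'I_K.+1) = (i == j).
Proof. by move=> hi hj; rewrite -val_eqE /= !inordK. Qed.

Section Instructions.
Variables (pc : nat) (s : store G) (pc_lt : pc < size code).

Let pcE : (inord pc : 'I_(size code).+1) = pc :> nat.
Proof. by rewrite inordK // ltnW. Qed.

Let pc_neq : ((inord pc : 'I_(size code).+1) == size code :> nat) = false.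
Proof. by rewrite pcE; apply/negbTE; rewrite neq_ltn pc_lt. Qed.

Lemma reaches_jump l :
  nth (IJump 0) code pc = IJump l -> reaches pc s 1 l s.
Proof.
move=> Ec c [Hc Hm]; exists 1 => //=; rewrite (step_vm Hc) /= pc_neq pcE Ec /=.
by split=> // i hi; rewrite !ffunE /=; apply/holds_stay/Hm.
Qed.

Lemma reaches_branch i t l : i <= K ->
  nth (IJump 0) code pc = IBranch i t l ->
  reaches pc s 1 (if top t (s i) then pc.+1 else l) s.
Proof.
move=> hi Ec c [Hc Hm]; exists 1 => //=; rewrite (step_vm Hc) /= pc_neq pcE Ec /=.
split=> [|j hj]; last by rewrite !ffunE /=; apply/holds_stay/Hm.
rewrite /= ffunE (holds_top (Hm i hi)).
by case: (s i) => //= x _; case: ifP.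
Qed.

Lemma reaches_pop i : i <= K ->
  nth (IJump 0) code pc = IPop i -> reaches pc s 1 pc.+1 (upd s i (behead (s i))).
Proof.
move=> hi Ec c [Hc Hm]; exists 1 => //=; rewrite (step_vm Hc) /= pc_neq pcE Ec /=.
split=> // j hj; rewrite !ffunE /= inord_inj // /upd; case: eqP => [->|_].
  exact/holds_pop/Hm.
exact/holds_stay/Hm.
Qed.

Lemma reaches_push i x : i <= K ->
  nth (IJump 0) code pc = IPush i x -> reaches pc s 2 pc.+1 (upd s i (x :: s i)).
Proof.
move=> hi Ec c [Hc Hm]; exists 2 => //=; rewrite (step_vm Hc) /= pc_neq pcE Ec /=.
rewrite (@step_vm _ (inord pc : 'I_(size code).+1) true) //= pc_neq pcE Ec /=.
split=> // j hj; rewrite !ffunE /= !inord_inj // /upd.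
case: eqP => [->|_]; rewrite ?ffunE /=; first exact/holds_push/Hm.
exact/holds_stay/holds_stay/Hm.
Qed.

Lemma reaches_copy i j x l : i <= K -> j <= K -> i != j -> s i = x :: l ->
  nth (IJump 0) code pc = ICopy i j -> reaches pc s 2 pc.+1 (upd s j (x :: s j)).
Proof.
move=> hi hj ij Es Ec c [Hc Hm]; exists 2 => //=.
rewrite (step_vm Hc) /= pc_neq pcE Ec /=.
rewrite (@step_vm _ (inord pc : 'I_(size code).+1) true) //= pc_neq pcE Ec /=.
split=> // k hk; rewrite !ffunE /= !inord_inj // (negbTE ij) /upd.
have -> : scanned (act (memory c (inord i)) (scanned (memory c (inord i)), Stay))
     = Some x by have := holds_top (Hm i hi); rewrite Es /= => <-; case: (memory c _).
case: eqP => [->|_]; rewrite ?ffunE /=; first exact/holds_push/Hm.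
exact/holds_stay/holds_stay/Hm.
Qed.

End Instructions.

(** The induction needs the code of [c] at an arbitrary address inside a larger program. The bound
    is doubled because pushing and copying take two machine steps. *)
Lemma reaches_run c s n s' : run c s n s' -> registers c <= K ->
  forall a z, code = a ++ compile (size a) c ++ z ->
  reaches (size a) s (n + n) (size a + code_size c) s'.
Proof.
have at_ a i z : code = a ++ i :: z ->
    size a < size code /\ nth (IJump 0) code (size a) = i.
  by move=> ->; rewrite size_cat nth_cat ltnn subnn addnS ltnS leq_addr.
elim=> {c s n s'}.
- by move=> i x s /= hi a z /= /at_[lt_a Ea]; rewrite [size a + _]addn1; apply: reaches_push.
- move=> i s /= hi a z /= /at_[lt_a Ea]; rewrite [size a + _]addn1.
  by apply: (@reaches_leq _ _ 1) => //; apply: reaches_pop.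
- move=> i j s x l ij Es /=; rewrite geq_max => /andP[hi hj] a z /at_[lt_a Ea].
  by rewrite [size a + _]addn1; apply: (reaches_copy _ _ _ _ Es Ea).
- move=> c1 c2 s s1 s2 n1 n2 _ IH1 _ IH2 /=; rewrite geq_max => /andP[h1 h2] a z.
  rewrite -catA => E; have R1 := IH1 h1 _ _ E.
  have {}IH2 := IH2 h2 (a ++ compile (size a) c1) z.
  rewrite size_cat size_compile -catA in IH2.
  by rewrite addnACA [size a + _]addnA; apply: reaches_trans R1 (IH2 E).
- move=> i t c1 c2 s s' n _ IH /=; rewrite !geq_max => /and3P[hi h1 h2] a z.
  rewrite /= -catA => E; have [lt_a Ea] := at_ _ _ _ E.
  have R := reaches_branch (s := s) lt_a hi Ea.
  apply: (@reaches_leq _ _ (1 + (n + n + 1))); first lia.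
  apply: reaches_trans R _.
  case: ifP IH => _ IH.
    have {}IH := IH h1 (rcons a (IBranch i t (size a + code_size c1).+2)).
    rewrite size_rcons in IH; rewrite -cat_rcons in E.
    apply: reaches_trans (IH _ E) _.
    rewrite catA in E; have [lt_b Eb] := at_ _ _ _ E.
    rewrite size_cat size_rcons size_compile in lt_b Eb.
    have := reaches_jump (s := s') lt_b Eb.
    by rewrite !addSn !addnS addnA.
  have {}IH := IH h2 (a ++ (IBranch i t (size a + code_size c1).+2 ::
     compile (size a).+1 c1 ++ [:: IJump (size a + code_size c1 + code_size c2).+2])) z.
  rewrite size_cat /= size_cat size_compile /= addn1 !addnS in IH.
  apply: (@reaches_leq _ _ (n + n)); first by lia.
  rewrite !addSn in IH; rewrite !addnS addnA; apply: IH.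
  by rewrite E -!catA /= -!catA.
- move=> i t c s Ht /=; rewrite geq_max => /andP[hi hc] a z.
  rewrite /= -catA => E; have [lt_a Ea] := at_ _ _ _ E.
  have := reaches_branch (s := s) lt_a hi Ea; rewrite Ht !addnS.
  exact: reaches_leq.
- move=> i t c s s1 s2 n1 n2 Ht _ IH1 _ IH2 /= hic a z E.
  have {}IH2 := IH2 hic a z E.
  move: hic; rewrite geq_max => /andP[hi hc].
  move: E; rewrite /= -catA => E; have [lt_a Ea] := at_ _ _ _ E.
  have := reaches_branch (s := s) lt_a hi Ea; rewrite Ht => R.
  have {}IH1 := IH1 hc (rcons a (IBranch i t (size a + code_size c).+2)).
  rewrite size_rcons in IH1; rewrite -cat_rcons in E.
  have := reaches_trans (reaches_trans R (IH1 _ E)).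
  rewrite catA in E; have [lt_b Eb] := at_ _ _ _ E.
  rewrite size_cat size_rcons size_compile in lt_b Eb.
  have RJ := reaches_jump (s := s1) lt_b Eb.
  move=> /(_ _ _ _ RJ) R3; have := reaches_trans R3 IH2.
  apply: reaches_leq; lia.
Qed.

End Simulation.

(** Polynomials with natural coefficients, presented as functions so that monotonicity and closure
    under composition are plain inductions; [pol_horner] returns to [{poly nat}] at the end. *)
Inductive pol : (nat -> nat) -> Prop :=
  | pol_const k : pol (fun=> k)
  | pol_id : pol id
  | pol_add f g : pol f -> pol g -> pol (fun n => f n + g n)
  | pol_mul f g : pol f -> pol g -> pol (fun n => f n * g n).

Lemma pol_homo f : pol f -> {homo f : m n / m <= n}.
Proof.
elim=> {f} [k|//|f g _ IHf _ IHg|f g _ IHf _ IHg] m n le_mn //.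
  by rewrite leq_add ?IHf ?IHg.
by rewrite leq_mul ?IHf ?IHg.
Qed.

Lemma pol_comp f g : pol f -> pol g -> pol (fun n => f (g n)).
Proof. by move=> Hf Hg; elim: Hf => {f}; eauto using pol. Qed.

Lemma pol_S f : pol f -> pol (fun n => (f n).+1).
Proof. by move=> Hf; apply: (pol_add (pol_const 1) Hf). Qed.

Lemma pol_horner f : pol f -> exists p : {poly nat}, forall n, f n = (p.[n])%R.
Proof.
elim=> {f} [k||f g _ [p Hp] _ [q Hq]|f g _ [p Hp] _ [q Hq]].
- by exists (k%:P)%R => n; rewrite hornerC.
- by exists 'X%R => n; rewrite hornerX.
- by exists (p + q)%R => n; rewrite hornerD Hp Hq.
- by exists (p * q)%R => n; rewrite hornerM Hp Hq.
Qed.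

Lemma class_P_run (A : finType) (c : cmd (A + bool)) (f : nat -> nat)
    (L : seq A -> Prop) : pol f ->
  (forall w, exists n s b l,
    [/\ run c (fun i => if i == 0 then map inl w else [::]) n s, n <= f (size w),
        s 0 = inr b :: l & b <-> L w]) -> class_P L.
Proof.
move=> /pol_horner[p Hp] H; set K := registers c; set code := compile 0 c.
(* Two machine steps per unit of cost, and one more from the exit address to the verdict. *)
exists (@vm A K code), (p + p + 1)%R => w.
have [n [s [b [l [R le_n Es HL]]]]] := H w.
have : represents (start_configuration (@vm A K code) w) 0
    (fun i => if i == 0 then map inl w else [::]).
  split=> [|i le_iK] /=.
    by congr (inl (_, _)); apply: val_inj; rewrite /= inordK.
  rewrite ffunE -val_eqE /= inordK // => k; case: eqP => _ /=; last by case: k => [|[]].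
  by rewrite -map_comp; case: w {H R le_n HL} => [|a w] //; case: k => [|[]].
have E : code = [::] ++ compile 0 c ++ [::] by rewrite cats0.
move=> /(reaches_run R (leqnn K) E)[m le_m [Hc Hm]].
exists m.+1, b; split=> //.
  rewrite !hornerD hornerC -Hp -[leqRHS]/(f (size w) + f (size w) + 1)%N; lia.
rewrite /halts_with iterS (step_vm Hc) /= inordK add0n -?(size_compile 0) // eqxx /=.
rewrite ffunE; have -> : ord0 = inord 0 :> 'I_K.+1 by apply: val_inj; rewrite /= inordK.
by rewrite (holds_top (Hm 0 isT)) Es; case: (b).
Qed.

(** * Functions computable in polynomial time *)

Inductive tree := Lf | Br of tree & tree.

(** Preorder is self-delimiting: the end of a subtree is found by counting, so pairs need no
    separators. *)
Fixpoint ser (t : tree) : seq bool :=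
  if t is Br a b then true :: ser a ++ ser b else [:: false].

Definition tree_size (t : tree) := size (ser t).

Lemma tree_sizeE a b : tree_size (Br a b) = (tree_size a + tree_size b).+1.
Proof. by rewrite /tree_size /= size_cat. Qed.

Lemma tree_size_gt0 t : 0 < tree_size t.
Proof. by case: t. Qed.

HB.mixin Record isCoded T := { code : T -> tree; code_inj : injective code }.
#[short(type="codedType")]
HB.structure Definition Coded := { T of isCoded T }.

HB.instance Definition _ := @isCoded.Build tree id (fun _ _ => id).

Fact code_bool_inj : injective (fun b : bool => if b then Br Lf Lf else Lf).
Proof. by do 2!case. Qed.
HB.instance Definition _ := isCoded.Build bool code_bool_inj.

Fact code_prod_inj (X Y : codedType) :
  injective (fun x : X * Y => Br (code x.1) (code x.2)).
Proof. by move=> [x y] [x' y'] /= [/code_inj-> /code_inj->]. Qed.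
HB.instance Definition _ (X Y : codedType) :=
  isCoded.Build (X * Y)%type (@code_prod_inj X Y).

Fixpoint code_seq (X : codedType) (s : seq X) : tree :=
  if s is x :: s' then Br (code x) (code_seq s') else Lf.

Fact code_seq_inj (X : codedType) : injective (@code_seq X).
Proof. by elim=> [|x s IH] [|y t] //= [/code_inj-> /IH->]. Qed.
HB.instance Definition _ (X : codedType) := isCoded.Build (seq X) (@code_seq_inj X).

Notation sym := (symbol + bool)%type.
Notation word t := (map inr (ser t) : seq sym).

Definition does (c : cmd sym) s n s' := exists2 m, m <= n & run c s m s'.

Lemma does_seq c1 c2 s n1 s1 n2 s2 :
  does c1 s n1 s1 -> does c2 s1 n2 s2 -> does (Seq c1 c2) s (n1 + n2) s2.
Proof.
move=> [m1 le1 R1] [m2 le2 R2]; exists (m1 + m2); first exact: leq_add.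
exact: run_seq R1 R2.
Qed.

Lemma does_leq c s n m s' : n <= m -> does c s n s' -> does c s m s'.
Proof. by move=> le_nm [k le_kn R]; exists k => //; apply: leq_trans le_nm. Qed.

Lemma does_if i t c1 c2 s n s' :
  does (if top t (s i) then c1 else c2) s n s' -> does (If i t c1 c2) s n.+2 s'.
Proof. by case=> m le_m R; exists m.+2 => //; apply: run_if. Qed.

Lemma does_push i x s : does (Push i x) s 1 (upd s i (x :: s i)).
Proof. by exists 1 => //; constructor. Qed.

Lemma does_pop i s : does (Pop i) s 1 (upd s i (behead (s i))).
Proof. by exists 1 => //; constructor. Qed.

Lemma does_copy i j s x l : i != j -> s i = x :: l ->
  does (Copy i j) s 1 (upd s j (x :: s j)).
Proof. by move=> ij E; exists 1 => //; apply: run_copy E. Qed.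

Lemma does_while_false i t c s : top t (s i) = false -> does (While i t c) s 1 s.
Proof. by move=> H; exists 1 => //; apply: run_while_false. Qed.

Lemma does_while_true i t c s n1 s1 n2 s2 : top t (s i) ->
  does c s n1 s1 -> does (While i t c) s1 n2 s2 ->
  does (While i t c) s (n1 + n2).+2 s2.
Proof.
move=> Ht [m1 le1 R1] [m2 le2 R2]; exists (m1 + m2).+2; first by rewrite !ltnS leq_add.
exact: run_while_true R1 R2.
Qed.

Lemma does_eq c s n s1 s2 : s1 =1 s2 -> does c s n s1 -> does c s n s2.
Proof. by move/functional_extensionality => ->. Qed.

Lemma does_cong c s n n' s1 s2 : n <= n' -> s1 =1 s2 -> does c s n s1 -> does c s n' s2.
Proof. by move=> le_n E H; apply: does_leq le_n (does_eq E H). Qed.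

Lemma does_step c1 c2 s s1' n1 s1 m1 m2 s2 :
  does c1 s n1 s1 -> n1 <= m1 -> s1 =1 s1' -> does c2 s1' m2 s2 ->
  does (Seq c1 c2) s (m1 + m2) s2.
Proof. by move=> H1 le1 E; apply: does_seq (does_cong le1 E H1). Qed.

Arguments does_step {c1 c2 s} s1' {n1 s1 m1 m2 s2}.

Lemma does_eq' c s n s1 s2 : s1 =1 s2 -> does c s1 n s -> does c s2 n s.
Proof. by move/functional_extensionality => ->. Qed.

Ltac eval_store :=
  rewrite /upd; repeat (case: eqP => //= ?); try congruence; try lia;
  try (subst => //; try congruence; try lia).

Ltac store := let k := fresh "k" in move=> k; eval_store.

(** * Basic stack routines *)

Definition move_rev i j : cmd sym := While i predT (Seq (Copy i j) (Pop i)).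

Lemma does_move_rev s i j : i != j ->
  does (move_rev i j) s (4 * size (s i) + 1)
    (upd (upd s j (catrev (s i) (s j))) i [::]).
Proof.
move=> ij; move El: (s i) => l; elim: l s El => [|x l IH] s El.
  apply: (@does_eq _ _ _ s); first by store.
  by apply: does_while_false; rewrite El.
have -> : 4 * size (x :: l) + 1 = (1 + 1 + (4 * size l + 1)).+2 by rewrite /=; lia.
apply: does_while_true; first by rewrite El.
  exact: does_seq (does_copy ij El) (does_pop _ _).
apply: does_eq (IH _ _); last first.
  by rewrite /upd eqxx (negbTE ij) El.
by store.
Qed.

Definition move i j t := Seq (move_rev i t) (move_rev t j).

Lemma does_move s i j t : i != j -> i != t -> j != t -> s t = [::] ->
  does (move i j t) s (8 * size (s i) + 2) (upd (upd s j (s i ++ s j)) i [::]).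
Proof.
move=> ij it jt Et.
have tj : t != j by rewrite eq_sym.
apply: does_cong (does_seq (does_move_rev _ it) (does_move_rev _ tj)).
  by rewrite /upd eqxx eq_sym (negbTE it) Et catrevE size_cat size_rev /=; lia.
by rewrite Et !catrevE cats0; store; rewrite ?revK //; lia.
Qed.

Definition unrev2 i j k : cmd sym :=
  While i predT (Seq (Seq (Copy i j) (Copy i k)) (Pop i)).

Lemma does_unrev2 s i j k : i != j -> i != k -> j != k ->
  does (unrev2 i j k) s (5 * size (s i) + 1)
    (upd (upd (upd s j (catrev (s i) (s j))) k (catrev (s i) (s k))) i [::]).
Proof.
move=> ij ik jk; move El: (s i) => l; elim: l s El => [|x l IH] s El.
  apply: (@does_eq _ _ _ s); first by store.
  by apply: does_while_false; rewrite El.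
have -> : 5 * size (x :: l) + 1 = (1 + 1 + 1 + (5 * size l + 1)).+2 by rewrite /=; lia.
apply: does_while_true; first by rewrite El.
  apply: does_seq (does_pop _ _); apply: does_seq (does_copy ij El) _.
  by apply: does_copy ik _; rewrite /upd (negbTE ij) El.
apply: does_eq (IH _ _); last first.
  by rewrite /upd eqxx (negbTE ij) (negbTE ik) El.
by store.
Qed.

Definition dup i k t := Seq (move_rev i t) (unrev2 t i k).

Lemma does_dup s i k t : i != k -> i != t -> k != t -> s t = [::] -> s k = [::] ->
  does (dup i k t) s (9 * size (s i) + 2) (upd s k (s i)).
Proof.
move=> ik it kt Et Ek.
have ti : t != i by rewrite eq_sym.
have tk : t != k by rewrite eq_sym.
apply: does_cong (does_seq (does_move_rev _ it) (does_unrev2 _ ti tk ik)).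
  by rewrite /upd eqxx eq_sym (negbTE it) Et catrevE size_cat size_rev /=; lia.
by rewrite Et !catrevE cats0; store; rewrite ?revK ?cats0 ?Ek ?cats0 //; lia.
Qed.

Definition clear i : cmd sym := While i predT (Pop i).

Lemma does_clear s i : does (clear i) s (3 * size (s i) + 1) (upd s i [::]).
Proof.
move El: (s i) => l; elim: l s El => [|x l IH] s El.
  apply: (@does_eq _ _ _ s); first by store.
  by apply: does_while_false; rewrite El.
have -> : 3 * size (x :: l) + 1 = (1 + (3 * size l + 1)).+2 by rewrite /=; lia.
apply: does_while_true (does_pop _ _) _; first by rewrite El.
apply: does_eq (IH _ _); last by rewrite /upd eqxx El.
by store.
Qed.

Definition nop : cmd sym := Seq (Push 0 (inr true)) (Pop 0).

Lemma does_nop s : does nop s 2 s.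
Proof. by apply: does_eq (does_seq (does_push _ _ _) (does_pop _ _)); store. Qed.

Definition pushes i (u : seq sym) : cmd sym := foldr (fun x c => Seq c (Push i x)) nop u.

Lemma does_pushes s i u : does (pushes i u) s (size u + 2) (upd s i (u ++ s i)).
Proof.
elim: u => [|x u IH] /=; first by apply: does_eq (does_nop _); store.
apply: does_cong (does_seq IH (does_push _ _ _)); first lia.
by store.
Qed.

Definition is_br (x : sym) : bool := if x is inr b then b else false.

(* The stack [c] counts the subtrees that remain to be read. *)
Definition take_tree i j c : cmd sym :=
  Seq (Push c (inr true))
      (While c predT
         (If i is_br (Seq (Seq (Copy i j) (Pop i)) (Push c (inr true)))
                   (Seq (Seq (Copy i j) (Pop i)) (Pop c)))).

Lemma does_take_tree s i j c t l : i != j -> i != c -> j != c ->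
  s i = word t ++ l -> s c = [::] ->
  does (take_tree i j c) s (7 * tree_size t + 2)
    (upd (upd s j (catrev (word t) (s j))) i l).
Proof.
move=> ij ic jc Ei Ec; rewrite /take_tree; set body := While _ _ _.
have [ji ci cj] : [/\ j != i, c != i & c != j] by split; rewrite eq_sym.
(* In continuation form: whatever the loop does after [t'] has been read is carried along, so that
   the second subtree can be handled as the continuation of the first. Each symbol costs seven:
   three instructions and the overheads of [If] and [While]. *)
have loop t' l' u s1 s2 m : s1 i = word t' ++ l' -> s1 c = inr true :: u ->
    does body (upd (upd (upd s1 j (catrev (word t') (s1 j))) i l') c u) m s2 ->
    does body s1 (7 * tree_size t' + m) s2.
  elim: t' l' u s1 s2 m => [|a IHa b IHb] l' u s1 s2 m E1 E2 H.
    have -> : 7 * tree_size Lf + m = ((1 + 1 + 1).+2 + m).+2 by rewrite /tree_size /=; lia.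
    apply: (does_while_true _ _ H); first by rewrite E2.
    apply: does_if; rewrite E1 /=.
    apply: does_eq (does_seq (does_seq (does_copy ij E1) (does_pop _ _)) (does_pop _ _)).
    by store; rewrite ?E1 ?E2.
  have -> : 7 * tree_size (Br a b) + m =
      ((1 + 1 + 1).+2 + (7 * tree_size a + (7 * tree_size b + m))).+2.
    by rewrite tree_sizeE; lia.
  rewrite /= map_cat -catA in E1.
  apply: does_while_true; first by rewrite E2.
    apply: does_if; rewrite E1 /=.
    exact: (does_seq (does_seq (does_copy ij E1) (does_pop _ _)) (does_push _ _ _)).
  apply: (IHa (word b ++ l') (s1 c)).
  - by rewrite /upd (negbTE ic) eqxx (negbTE ij) E1.
  - by rewrite /upd eqxx (negbTE ci) (negbTE cj).
  apply: (IHb l' u).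
  - by rewrite /upd (negbTE ic) eqxx.
  - by rewrite /upd eqxx E2.
  apply: does_eq' H.
  by store; rewrite /= ?catrevE ?map_cat ?rev_cons ?rev_cat ?cat_rcons -?catA.
rewrite -[_ + 2]/(_ + (1 + 1)).
apply: does_cong (does_seq (does_push _ _ _) (loop t l [::] _ _ 1 _ _ _)).
- lia.
- by [].
- by rewrite /upd (negbTE ic) Ei.
- by rewrite /upd eqxx Ec.
- apply: does_cong (does_while_false _ _) => //; last by rewrite /upd eqxx.
  by store.
Qed.

(* The value is held on stack 0; the stacks 1, .., k-1 serve as work space and
   the stacks from k on are left alone. *)
Definition polytime (X Y : codedType) (f : X -> Y) : Prop :=
  exists c k p, pol p /\ forall x,
    tree_size (code (f x)) <= p (tree_size (code x)) /\
    forall s, s 0 = word (code x) -> (forall i, 0 < i < k -> s i = [::]) ->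
    does c s (p (tree_size (code x))) (upd s 0 (word (code (f x)))).

Ltac pol :=
  repeat first [ assumption | apply: pol_id | apply: pol_const | apply: pol_S
    | apply: pol_add | apply: pol_mul | apply: pol_comp; [assumption|] ].

Lemma size_word t : size (word t) = tree_size t.
Proof. by rewrite size_map. Qed.

(** * Closure properties of polynomial-time functions *)

Lemma polytime_id (X : codedType) : polytime (@id X).
Proof.
exists nop, 0, (fun n => n + 2); split=> [|x]; first by pol.
split=> [|s Es _]; first exact: leq_addr.
by apply: does_cong (does_nop s); [lia | store].
Qed.

Lemma polytime_ext (X Y : codedType) (f g : X -> Y) : f =1 g -> polytime f -> polytime g.
Proof.
move=> E [c [k [p [Hp H]]]]; exists c, k, p; split=> // x; rewrite -E; exact: H.
Qed.

Lemma polytime_comp (X Y Z : codedType) (g : Y -> Z) (f : X -> Y) :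
  polytime g -> polytime f -> polytime (fun x => g (f x)).
Proof.
move=> [cg [kg [pg [Hpg Hg]]]] [cf [kf [pf [Hpf Hf]]]].
exists (Seq cf cg), (maxn kf kg), (fun n => pf n + pg (pf n)).
split=> [|x]; first by pol.
have [le_f Rf] := Hf x; have [le_g Rg] := Hg (f x); split.
  by apply: leq_trans le_g _; apply: leq_trans (leq_addl _ _); apply: pol_homo.
move=> s Es Ew; have /(_ s Es) {}Rf := Rf.
apply: does_cong (does_seq (Rf _) (Rg _ _ _)) => //.
- by rewrite leq_add2l; apply: pol_homo.
- by store.
- by move=> i hi; apply: Ew; lia.
- by move=> i hi; rewrite /upd; case: eqP => [|_]; [lia | apply: Ew; lia].
Qed.

Lemma polytime_const (X Y : codedType) (y : Y) : polytime (fun _ : X => y).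
Proof.
exists (Seq (clear 0) (pushes 0 (word (code y)))), 0.
exists (fun n => 3 * n + 1 + (tree_size (code y) + 2)); split=> [|x]; first by pol.
split=> [|s Es _]; first lia.
apply: does_cong (does_seq (does_clear s 0) (does_pushes _ _ _)).
  by rewrite Es !size_map.
by store; rewrite cats0.
Qed.

Lemma polytime_pair (X Y Z : codedType) (f : X -> Y) (g : X -> Z) :
  polytime f -> polytime g -> polytime (fun x => (f x, g x)).
Proof.
move=> [cf [kf [pf [Hpf Hf]]]] [cg [kg [pg [Hpg Hg]]]].
(* From [K] on, the stacks are out of reach of both programs: [K] keeps the input, [K.+1] keeps the
   reversed word of [f x], and [K.+2] is scratch space. *)
pose K := (maxn kf kg).+1.
exists (Seq (dup 0 K K.+1) (Seq cf (Seq (move_rev 0 K.+1) (Seq (move K 0 K.+2)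
  (Seq cg (Seq (move_rev K.+1 0) (Push 0 (inr true)))))))), K.+3.
exists (fun n => (9 * n + 2) + (pf n + ((4 * pf n + 1) + ((8 * n + 2) +
  (pg n + ((4 * pf n + 1) + 1)))))).
split=> [|x]; first by pol.
have [le_f Rf] := Hf x; have [le_g Rg] := Hg x; split.
  by rewrite [tree_size _](tree_sizeE (code (f x)) (code (g x))); lia.
move=> s Es Ew.
have EK : s K = [::] by apply: Ew; lia.
have EK1 : s K.+1 = [::] by apply: Ew; lia.
have EK2 : s K.+2 = [::] by apply: Ew; lia.
have Ew1 i : 0 < i < kf -> s i = [::] by move=> hi; apply: Ew; lia.
have Ew2 i : 0 < i < kg -> s i = [::] by move=> hi; apply: Ew; lia.
have leK1 : kf <= K by lia.
have leK2 : kg <= K by lia.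
have K0 : 0 != K by [].
have KK1 : K != K.+1 by rewrite neq_ltn leqnn.
move: K EK EK1 EK2 leK1 leK2 K0 KK1 {Ew} => K EK EK1 EK2 leK1 leK2 K0 KK1.
set wx := word (code x); set wf := word (code (f x)); set wg := word (code (g x)).
apply: (does_step (upd s K wx) (@does_dup _ 0 K K.+1 _ _ _ _ _)) => //.
- by rewrite Es size_word.
- by store.
apply: (does_step (upd (upd s K wx) 0 wf) (Rf _ _ _)) => //.
- by eval_store.
- by move=> i hi; eval_store; apply: Ew1.
apply: (does_step (upd (upd (upd s K wx) K.+1 (rev wf)) 0 [::])
         (@does_move_rev _ 0 K.+1 _)) => //.
- by rewrite /upd eqxx size_word; lia.
- by rewrite catrevE; store; rewrite EK1 cats0.
apply: (does_step (upd (upd s K.+1 (rev wf)) 0 wx)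
         (@does_move _ K 0 K.+2 _ _ _ _)) => //; try by eval_store.
- by eval_store; rewrite size_word.
- by store; rewrite cats0.
apply: (does_step (upd (upd s K.+1 (rev wf)) 0 wg) (Rg _ _ _)) => //; try by store.
- by move=> i hi; eval_store; apply: Ew2.
apply: (does_step (upd s 0 (wf ++ wg)) (@does_move_rev _ K.+1 0 _)) => //.
- by rewrite /upd eqxx /= size_rev size_word; lia.
- by rewrite catrevE; store; rewrite revK.
apply: does_eq (does_push _ _ _); store; rewrite -map_cat //.
Qed.

Lemma polytime_proj1 (X Y : codedType) : polytime (@fst X Y).
Proof.
exists (Seq (Pop 0) (Seq (take_tree 0 1 2) (Seq (clear 0) (move_rev 1 0)))), 3.
exists (fun n => 1 + ((7 * n + 2) + ((3 * n + 1) + (4 * n + 1)))).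
split=> [|[a b]]; first by pol.
rewrite [tree_size (code (a, b))]tree_sizeE /=; split=> [|s Es Ew]; first lia.
have E1 : s 1 = [::] by apply: Ew.
have E2 : s 2 = [::] by apply: Ew.
have {}Es : s 0 = inr true :: word (code a) ++ word (code b) by rewrite Es /= map_cat.
apply: (does_step (upd s 0 (word (code a) ++ word (code b))) (does_pop 0 s)) => //.
  by rewrite Es.
apply: (does_step (upd (upd s 1 (rev (word (code a)))) 0 (word (code b)))
         (@does_take_tree _ 0 1 2 (code a) (word (code b)) _ _ _ _ _)) => //.
- lia.
- by store; rewrite E1.
apply: (does_step (upd (upd s 1 (rev (word (code a)))) 0 [::]) (does_clear _ _)) => //.
- by eval_store; rewrite size_word; lia.
- by store.
apply: does_cong (does_move_rev _ _) => //.
- by eval_store; rewrite size_rev size_word; lia.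
- by store; rewrite catrevE revK cats0.
Qed.

Lemma polytime_proj2 (X Y : codedType) : polytime (@snd X Y).
Proof.
exists (Seq (Pop 0) (Seq (take_tree 0 1 2) (clear 1))), 3.
exists (fun n => 1 + ((7 * n + 2) + (3 * n + 1))).
split=> [|[a b]]; first by pol.
rewrite [tree_size (code (a, b))]tree_sizeE /=; split=> [|s Es Ew]; first lia.
have E1 : s 1 = [::] by apply: Ew.
have E2 : s 2 = [::] by apply: Ew.
have {}Es : s 0 = inr true :: word (code a) ++ word (code b) by rewrite Es /= map_cat.
apply: (does_step (upd s 0 (word (code a) ++ word (code b))) (does_pop 0 s)) => //.
  by rewrite Es.
apply: (does_step (upd (upd s 1 (rev (word (code a)))) 0 (word (code b)))
         (@does_take_tree _ 0 1 2 (code a) (word (code b)) _ _ _ _ _)) => //.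
- lia.
- by store; rewrite E1.
apply: does_cong (does_clear _ _) => //.
- by eval_store; rewrite size_rev size_word; lia.
- by store.
Qed.

(** A nonempty list has the same code as the pair of its head and tail. Hence it is enough to test
    one bit and to put the saved input in front of the word of the list. *)
Lemma polytime_case (X Y Z : codedType) (l : X -> seq Y) (n : X -> Z)
    (c : X * (Y * seq Y) -> Z) :
  polytime l -> polytime n -> polytime c ->
  polytime (fun x => if l x is y :: s then c (x, (y, s)) else n x).
Proof.
move=> [cl [kl [pl [Hpl Hl]]]] [cn [kn [pn [Hpn Hn]]]] [cc [kc [pc [Hpc Hc]]]].
pose K := (maxn kl (maxn kn kc)).+1.
exists (Seq (dup 0 K K.+1) (Seq cl (If 0 is_br
   (Seq (move K 0 K.+1) (Seq (Push 0 (inr true)) cc))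
   (Seq (clear 0) (Seq (move K 0 K.+1) cn))))), K.+2.
exists (fun n => (9 * n + 2) + (pl n + ((3 * 1 + 1) + ((8 * n + 2) +
  (1 + (pc (n + pl n).+1 + pn n)))).+2)).
split=> [|x]; first by pol; apply: (@pol_comp pc) => //; pol.
have [le_l Rl] := Hl x; have [le_n Rn] := Hn x.
set N := tree_size (code x).
have sizec y s : l x = y :: s -> tree_size (code (x, (y, s))) <= (N + pl N).+1.
  move=> E; rewrite E in le_l.
  by rewrite [tree_size _]tree_sizeE /= ltnS leq_add2l.
split.
  case E: (l x) => [|y s]; first by rewrite -/N in le_n *; lia.
  have [le_c _] := Hc (x, (y, s)).
  by have := leq_trans le_c (pol_homo Hpc (sizec _ _ E)); lia.
move=> s Es Ew.
have EK : s K = [::] by apply: Ew; lia.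
have EK1 : s K.+1 = [::] by apply: Ew; lia.
have Ewl i : 0 < i < kl -> s i = [::] by move=> hi; apply: Ew; lia.
have Ewn i : 0 < i < kn -> s i = [::] by move=> hi; apply: Ew; lia.
have Ewc i : 0 < i < kc -> s i = [::] by move=> hi; apply: Ew; lia.
have leK1 : kl <= K by lia.
have leK2 : kn <= K by lia.
have leK3 : kc <= K by lia.
have K0 : 0 != K by [].
have KK1 : K != K.+1 by rewrite neq_ltn leqnn.
move: K EK EK1 leK1 leK2 leK3 K0 KK1 {Ew} => K EK EK1 leK1 leK2 leK3 K0 KK1.
set wx := word (code x); set wl := word (code (l x)).
apply: (does_step (upd s K wx) (@does_dup _ 0 K K.+1 _ _ _ _ _)) => //.
- by rewrite Es size_word.
- by store.
apply: (does_step (upd (upd s K wx) 0 wl) (Rl _ _ _)) => //.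
- by eval_store.
- by move=> i hi; eval_store; apply: Ewl.
apply: does_if; rewrite {1}/upd eqxx {}/wl.
case E: (l x) => [|y t].
  apply: (@does_leq _ _ (3 * 1 + 1 + (8 * N + 2 + pn N))); first lia.
  apply: (does_step (upd (upd s K wx) 0 [::]) (does_clear _ _)) => //; first by store.
  apply: (does_step (upd s 0 wx) (@does_move _ K 0 K.+1 _ _ _ _)) => //.
  - by rewrite eq_sym.
  - by eval_store.
  - by eval_store; rewrite size_word.
  - by store; rewrite cats0.
  apply: does_eq (Rn _ _ _) => //; try by store.
  by move=> i hi; eval_store; apply: Ewn.
have [_ Rc] := Hc (x, (y, t)).
apply: (@does_leq _ _ (8 * N + 2 + (1 + pc (N + pl N).+1))); first lia.
apply: (does_step (upd s 0 (wx ++ word (code (l x))))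
         (@does_move _ K 0 K.+1 _ _ _ _)) => //; try by eval_store.
- by eval_store; rewrite size_word.
- by rewrite E; store.
apply: (does_step (upd s 0 (word (code (x, (y, t))))) (does_push _ _ _)) => //.
- by store; rewrite E /wx -map_cat.
apply: does_cong (Rc _ _ _) => //.
- exact/(pol_homo Hpc)/sizec.
- by store.
- by move=> i hi; eval_store; apply: Ewc.
Qed.

(** A copy of the input word serves as loop counter. The bound [q] on all intermediate values is
    essential, since iterating a polynomial-time function can make sizes grow exponentially. *)
Lemma polytime_iter (X : codedType) (g : X -> X) (q : nat -> nat) :
  polytime g -> pol q ->
  (forall x n, n <= tree_size (code x) ->
     tree_size (code (iter n g x)) <= q (tree_size (code x))) ->
  polytime (fun x => iter (tree_size (code x)) g x).
Proof.
move=> [cg [kg [pg [Hpg Hg]]]] Hq Bq; pose K := kg.+1.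
exists (Seq (dup 0 K K.+1) (While K predT (Seq (Pop K) cg))), K.+2.
exists (fun n => q n + ((9 * n + 2) + (n * (pg (q n) + 3) + 1))).
split=> [|x]; first by pol.
set N := tree_size (code x); split.
  by have := Bq x _ (leqnn _); rewrite -/N; lia.
move=> s Es Ew.
have EK : s K = [::] by apply: Ew; lia.
have EK1 : s K.+1 = [::] by apply: Ew; lia.
apply: (does_leq (leq_addl _ _)).
apply: (does_step (upd s K (word (code x))) (@does_dup _ 0 K K.+1 _ _ _ _ _)) => //.
- by rewrite neq_ltn leqnn.
- by rewrite Es size_word.
- by rewrite Es.
have loop u y s1 : s1 0 = word (code y) -> s1 K = u ->
    (forall i, 0 < i < K -> s1 i = [::]) ->
    (forall i, i <= size u -> tree_size (code (iter i g y)) <= q N) ->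
    does (While K predT (Seq (Pop K) cg)) s1 (size u * (pg (q N) + 3) + 1)
      (upd (upd s1 K [::]) 0 (word (code (iter (size u) g y)))).
  elim: u y s1 => [|a u IH] y s1 E0 E1 E2 B.
    by apply: does_cong (does_while_false _ _); rewrite ?E1 //; store.
  have -> : size (a :: u) * (pg (q N) + 3) + 1 =
      (1 + pg (q N) + (size u * (pg (q N) + 3) + 1)).+2 by rewrite /=; lia.
  have [_ R] := Hg y.
  apply: does_while_true; first by rewrite E1.
    apply: (does_step (upd s1 K u) (does_pop _ _)) => //; first by rewrite E1.
    apply: does_leq (R _ _ _).
    - by apply: pol_homo => //; apply: (B 0).
    - by eval_store.
    - by move=> i hi; eval_store; apply: E2; lia.
  apply: does_eq (IH (g y) _ _ _ _ _).
  - by rewrite /= -iterSr; store.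
  - by eval_store.
  - by eval_store.
  - by move=> i hi; eval_store; apply: E2; lia.
  - by move=> i hi; rewrite -iterSr; apply: B.
apply: does_cong (loop (word (code x)) x _ _ _ _ _).
- by rewrite size_word.
- by rewrite size_word; store.
- by eval_store.
- by eval_store.
- by move=> i hi; eval_store; apply: Ew; lia.
- by move=> i; rewrite size_word; apply: Bq.
Qed.

Fixpoint mismatches (u v : seq sym) : nat :=
  if u is x :: u' then
    (is_br x != top is_br v) + mismatches u' (behead v)
  else 0.

(** Agreeing bits force the same choice between leaf and branching at every node, so it suffices to
    scan the length of the first word. *)
Lemma mismatches_eq0 a b u v : mismatches (word a ++ u) (word b ++ v) = 0 ->
  a = b /\ mismatches u v = 0.
Proof.
elim: a b u v => [|a1 IH1 a2 IH2] [|b1 b2] u v //=.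
rewrite !map_cat -!catA => /IH1[-> /IH2[-> ?]] //.
Qed.

Lemma mismatches_refl u : mismatches u u = 0.
Proof. by elim: u => //= x u ->; rewrite eqxx. Qed.

Definition compare : cmd sym :=
  While 0 predT (Seq (Seq
    (If 0 is_br (If 2 is_br nop (Push 1 (inr true)))
                (If 2 is_br (Push 1 (inr true)) nop)) (Pop 0)) (Pop 2)).

Lemma does_compare s u v : s 0 = u -> s 2 = v ->
  does compare s (10 * size u + 1)
    (upd (upd (upd s 0 [::]) 2 (drop (size u) v)) 1
       (nseq (mismatches u v) (inr true) ++ s 1)).
Proof.
elim: u v s => [|x u IH] v s E0 E2.
  apply: does_cong (does_while_false _ _) => //; last by rewrite E0.
  by store; rewrite drop0.
have -> : 10 * size (x :: u) + 1 = ((6 + 1 + 1) + (10 * size u + 1)).+2 by rewrite /=; lia.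
pose s' := upd s 1 (nseq (is_br x != top is_br v) (inr true) ++ s 1).
apply: (@does_while_true _ _ _ _ _ (upd (upd s' 0 u) 2 (behead v))).
- by rewrite E0.
- have R b c : does (If 2 is_br (if b then nop else Push 1 (inr true))
      (if c then nop else Push 1 (inr true))) s 4
      (upd s 1 (nseq (if top is_br v then ~~ b else ~~ c) (inr true) ++ s 1)).
    apply: does_if; rewrite E2; case: (top is_br v).
      case: b => /=; first by apply: does_eq (does_nop _); store.
      by apply: does_leq (does_push _ _ _).
    case: c => /=; first by apply: does_eq (does_nop _); store.
    by apply: does_leq (does_push _ _ _).
  have IFR : does (If 0 is_br (If 2 is_br nop (Push 1 (inr true)))
                (If 2 is_br (Push 1 (inr true)) nop)) s 6 s'.
    have -> : s' = upd s 1 (nseq (if top is_br v then ~~ is_br x else ~~ ~~ is_br x)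
        (inr true) ++ s 1).
      by rewrite /s'; case: (is_br x); case: (top is_br v).
    apply: does_if; rewrite E0 /=.
    by have := R (is_br x) (~~ is_br x); case: (is_br x) => /=.
  apply: (@does_step _ _ _ (upd s' 0 u) _ _ (6 + 1) 1 _ (does_seq IFR (does_pop _ _))) => //.
  + by rewrite /s'; store; rewrite E0.
  + by apply: does_eq (does_pop _ _); rewrite /s'; store; rewrite E2.
apply: does_eq (IH (behead v) _ _ _); rewrite /s'.
- by store; [elim: (mismatches _ _) => //= n -> | case: (s 2)].
- by eval_store.
- by eval_store.
Qed.

Lemma polytime_eq_pair (X : codedType) (eqX : X -> X -> bool) :
  (forall x y, reflect (x = y) (eqX x y)) -> polytime (fun x : X * X => eqX x.1 x.2).
Proof.
move=> eqP'.
exists (Seq (Pop 0) (Seq (take_tree 0 1 3) (Seq (move_rev 1 2) (Seq compare (Seq (clear 2)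
  (If 1 predT (Seq (clear 1) (pushes 0 (word (code false))))
              (pushes 0 (word (code true))))))))), 4.
exists (fun n => 1 + ((7 * n + 2) + ((4 * n + 1) + ((10 * n + 1) + ((3 * n + 1) +
  (3 * n + 1 + 5).+2))))).
split=> [|[a b]]; first by pol.
rewrite [tree_size (code (a, b))]tree_sizeE /=; split=> [|s Es Ew].
  by case: (eqX a b); rewrite /code /tree_size /=; lia.
have E1 : s 1 = [::] by apply: Ew.
have E2 : s 2 = [::] by apply: Ew.
have E3 : s 3 = [::] by apply: Ew.
set wa := word (code a); set wb := word (code b).
have {}Es : s 0 = inr true :: wa ++ wb by rewrite Es /= map_cat.
apply: (does_step (upd s 0 (wa ++ wb)) (does_pop 0 s)) => //.
  by rewrite Es.
apply: (does_step (upd (upd s 1 (rev wa)) 0 wb)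
         (@does_take_tree _ 0 1 3 (code a) wb _ _ _ _ _)) => //.
- lia.
- by store; rewrite E1.
apply: (does_step (upd (upd s 2 wa) 0 wb) (@does_move_rev _ 1 2 _)) => //.
- by eval_store; rewrite size_rev size_word; lia.
- by store; rewrite catrevE revK E2 cats0.
set m := mismatches wb wa.
apply: (does_step (upd (upd (upd s 0 [::]) 2 (drop (size wb) wa)) 1 (nseq m (inr true)))
   (does_compare _ _)) => //.
- by eval_store; rewrite size_word; lia.
- by store; rewrite E1 cats0.
apply: (does_step (upd (upd s 0 [::]) 1 (nseq m (inr true))) (does_clear _ _)) => //.
- by eval_store; rewrite size_drop size_word; lia.
- by store.
apply: does_if.
have mE : (m == 0) = eqX a b.
  apply/eqP/eqP'; last by rewrite /m /wa /wb => ->; exact: mismatches_refl.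
  by rewrite /m /wa /wb -[word (code b)]cats0 -[word (code a)]cats0 =>
    /mismatches_eq0[/code_inj].
have le_m : m <= size wb.
  rewrite /m; elim: (wb) (wa) => //= x u IH v.
  by have := IH (behead v); case: (_ != _); lia.
have -> : top predT (upd (upd s 0 [::]) 1 (nseq m (inr true)) 1) = ~~ eqX a b.
  by rewrite -mE /upd /=; case: (m).
rewrite if_neg; case: (eqX a b) mE => mE.
  refine (does_cong _ _ (does_pushes _ 0 (word (code true)))).
    by rewrite [size _]/=; lia.
  by rewrite (eqP mE) /=; store.
apply: (@does_leq _ _ (3 * size wb + 1 + (1 + 2))); first by rewrite size_word; lia.
apply: (does_step (upd s 0 [::]) (does_clear _ _)) => //.
- by eval_store; rewrite size_nseq; lia.
- by store.
refine (does_eq _ (does_pushes _ 0 (word (code false)))); store.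
Qed.

Section Closure.
Variable X : codedType.

Lemma polytime_fst (Y Z : codedType) (f : X -> Y * Z) :
  polytime f -> polytime (fun x => (f x).1).
Proof. exact/polytime_comp/polytime_proj1. Qed.

Lemma polytime_snd (Y Z : codedType) (f : X -> Y * Z) :
  polytime f -> polytime (fun x => (f x).2).
Proof. exact/polytime_comp/polytime_proj2. Qed.

Lemma polytime_recode (Y Z : codedType) (f : X -> Y) (g : X -> Z) :
  (forall x, code (f x) = code (g x)) -> polytime f -> polytime g.
Proof.
move=> E [c [k [p [Hp H]]]]; exists c, k, p; split=> // x.
by rewrite -E; apply: H.
Qed.

Lemma polytime_cons (Y : codedType) (f : X -> Y) (g : X -> seq Y) :
  polytime f -> polytime g -> polytime (fun x => f x :: g x).
Proof. by move=> Hf Hg; apply: polytime_recode (polytime_pair Hf Hg). Qed.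

Lemma polytime_if (Y : codedType) (b : X -> bool) (f g : X -> Y) :
  polytime b -> polytime f -> polytime g ->
  polytime (fun x => if b x then f x else g x).
Proof.
move=> Hb Hf Hg.
(* [true] and [[:: Lf]] have the same code, and so have [false] and [[::]]. *)
have Hl : polytime (fun x => if b x then [:: Lf] else [::]).
  by apply: polytime_recode Hb => x; case: (b x).
have := polytime_case Hl Hg (polytime_comp Hf (@polytime_proj1 X _)).
by apply: polytime_ext => x /=; case: (b x).
Qed.

Lemma polytime_negb (b : X -> bool) : polytime b -> polytime (fun x => ~~ b x).
Proof.
move=> Hb.
have := polytime_if Hb (polytime_const _ false) (polytime_const _ true).
by apply: polytime_ext => x; case: (b x).
Qed.

Lemma polytime_and (b c : X -> bool) :
  polytime b -> polytime c -> polytime (fun x => b x && c x).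
Proof.
move=> Hb Hc; apply: polytime_ext (polytime_if Hb Hc (polytime_const _ false)).
by move=> x; case: (b x).
Qed.

Lemma polytime_isnil (Y : codedType) (f : X -> seq Y) :
  polytime f -> polytime (fun x => nilp (f x)).
Proof.
move=> Hf; have := polytime_case Hf (polytime_const _ true) (polytime_const _ false).
by apply: polytime_ext => x; case: (f x).
Qed.

Lemma polytime_behead (Y : codedType) (f : X -> seq Y) :
  polytime f -> polytime (fun x => behead (f x)).
Proof.
move=> Hf; have := polytime_case Hf (polytime_const _ [::])
  (polytime_comp (@polytime_proj2 _ _) (@polytime_proj2 X (Y * seq Y)%type)).
by apply: polytime_ext => x; case: (f x).
Qed.

Lemma polytime_head (Y : codedType) (y : Y) (f : X -> seq Y) :
  polytime f -> polytime (fun x => head y (f x)).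
Proof.
move=> Hf; have := polytime_case Hf (polytime_const _ y)
  (polytime_comp (@polytime_proj1 _ _) (@polytime_proj2 X (Y * seq Y)%type)).
by apply: polytime_ext => x; case: (f x).
Qed.

Lemma polytime_eq (Y : codedType) (eqY : Y -> Y -> bool) (f g : X -> Y) :
  (forall x y, reflect (x = y) (eqY x y)) -> polytime f -> polytime g ->
  polytime (fun x => eqY (f x) (g x)).
Proof.
by move=> H Hf Hg; apply: polytime_comp (polytime_eq_pair H) (polytime_pair Hf Hg).
Qed.

End Closure.

Lemma ser_inj : injective ser.
Proof.
move=> a b E; have : mismatches (word a ++ [::]) (word b ++ [::]) = 0.
  by rewrite E mismatches_refl.
by case/mismatches_eq0.
Qed.

Definition same_code (X : codedType) (x y : X) := ser (code x) == ser (code y).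

Lemma same_codeP (X : codedType) (x y : X) : reflect (x = y) (same_code x y).
Proof. by apply: (iffP eqP) => [/ser_inj/code_inj|->]. Qed.

(** Each [h a] may have a program and a polynomial of its own; as [e] is a finite list covering [F],
    nested tests combine them. *)
Lemma polytime_switch (X F Y Z : codedType) (a0 : F) (e : seq F) (h : F -> Y -> Z)
    (f : X -> F) (g : X -> Y) :
  (forall a, has (same_code a) e) -> (forall a, polytime (h a)) ->
  polytime f -> polytime g -> polytime (fun x => h (f x) (g x)).
Proof.
move=> he Hh Hf Hg.
have [k Hk Ek] : exists2 k : X -> Z, polytime k &
    forall x, has (same_code (f x)) e -> k x = h (f x) (g x).
  elim: e {he} => [|a e [k Hk Ek]].
    by exists (fun x => h a0 (g x)) => //; apply: polytime_comp.
  exists (fun x => if same_code (f x) a then h a (g x) else k x).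
    apply: polytime_if Hk; last exact: polytime_comp.
    apply: (polytime_eq (eqY := @same_code F)) (polytime_const _ _) => //.
    exact: same_codeP.
  by move=> x /=; case: same_codeP => [->//|_] /= /Ek.
by apply: polytime_ext Hk => x; apply: Ek.
Qed.

(** However [h] is defined, its finite table can be hard-wired into the program. *)
Lemma polytime_table (F Z : codedType) (a0 : F) (e : seq F) (h : F -> Z) :
  (forall a, has (same_code a) e) -> polytime h.
Proof.
move=> he; apply: (polytime_switch (h := fun a _ => h a) a0 he) => //.
- by move=> a; apply: polytime_const.
- exact: polytime_id.
- exact: (polytime_const _ Lf).
Qed.

(** The increment [r] does not see the accumulator [z], so after any number of steps the size has
    grown by at most the length of the list times one polynomial. The fold is an iteration on
    triples of parameter, accumulator and remaining list; surplus rounds do nothing once the list is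
    empty. *)
Lemma polytime_foldl_state (X Y Z : codedType) (g : X * (Z * Y) -> Z) (r : nat -> nat) :
  polytime g -> pol r ->
  (forall x z y, tree_size (code (g (x, (z, y)))) <=
     tree_size (code z) + r (tree_size (code x) + tree_size (code y))) ->
  polytime (fun s : X * (Z * seq Y) => foldl (fun z y => g (s.1, (z, y))) s.2.1 s.2.2).
Proof.
move=> Hg Hr B.
pose step (s : X * (Z * seq Y)) :=
  if s.2.2 is y :: t then (s.1, (g (s.1, (s.2.1, y)), t)) else s.
have stepE n x z l : iter n step (x, (z, l)) =
    (x, (foldl (fun z y => g (x, (z, y))) z (take n l), drop n l)).
  elim: n z l => [|n IH] z l; first by rewrite take0 drop0.
  rewrite iterSr {2}/step /=; case: l => [|y l] //=.
have size_seq (l : seq Y) : size l < tree_size (code l).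
  elim: l => [|y l IH] //; rewrite [tree_size _](tree_sizeE (code y) (code l)) /= ltnS.
  exact: leq_trans IH (leq_addl _ _).
have size_hd (y : Y) l : tree_size (code y) <= tree_size (code (y :: l)).
  by rewrite [tree_size (code (_ :: _))](tree_sizeE (code y) (code l)); lia.
have size_tl (y : Y) l : tree_size (code l) <= tree_size (code (y :: l)).
  by rewrite [tree_size (code (_ :: _))](tree_sizeE (code y) (code l)); lia.
have size_fold x z l : tree_size (code (foldl (fun z y => g (x, (z, y))) z l)) <=
    tree_size (code z) + size l * r (tree_size (code x) + tree_size (code l)).
  elim: l z => [|y l IH] z /=; first lia.
  apply: leq_trans (IH _) _; rewrite mulSn addnA; apply: leq_add.
    apply: leq_trans (B _ _ _) _; rewrite leq_add2l; apply: (pol_homo Hr).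
    by rewrite leq_add2l size_hd.
  by rewrite leq_mul2l; apply/orP; right; apply: (pol_homo Hr); rewrite leq_add2l.
have size_take n (l : seq Y) : tree_size (code (take n l)) <= tree_size (code l).
  elim: l n => [|y l IH] [|n] //=.
  rewrite [leqLHS](tree_sizeE (code y) (code (take n l))).
  by rewrite [leqRHS](tree_sizeE (code y) (code l)) ltnS leq_add2l.
have size_drop n (l : seq Y) : tree_size (code (drop n l)) <= tree_size (code l).
  elim: l n => [|y l IH] [|n] //=; apply: leq_trans (IH _) (size_tl _ _).
have Hstep : polytime step.
  have Hc : polytime (fun u : (X * (Z * seq Y)) * (Y * seq Y) =>
      (u.1.1, (g (u.1.1, (u.1.2.1, u.2.1)), u.2.2))).
    have P1 := @polytime_proj1 (X * (Z * seq Y))%type (Y * seq Y)%type.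
    have P2 := @polytime_proj2 (X * (Z * seq Y))%type (Y * seq Y)%type.
    apply: polytime_pair (polytime_fst P1) (polytime_pair _ (polytime_snd P2)).
    apply: polytime_comp Hg (polytime_pair (polytime_fst P1) _).
    exact: polytime_pair (polytime_fst (polytime_snd P1)) (polytime_fst P2).
  have Hl : polytime (fun s : X * (Z * seq Y) => s.2.2).
    exact: polytime_snd (@polytime_proj2 _ _).
  by apply: polytime_ext (polytime_case Hl (polytime_id _) Hc) => -[x [z [|y l]]].
have Hbound s n : n <= tree_size (code s) -> tree_size (code (iter n step s)) <=
    tree_size (code s) + tree_size (code s) * r (tree_size (code s)).
  case: s => x [z l] _; rewrite stepE.
  have sizeE a b c : tree_size (code ((a, (b, c)) : X * (Z * seq Y))) =
      (tree_size (code a) + (tree_size (code b) + tree_size (code c)).+1).+1.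
    by rewrite [LHS](tree_sizeE (code a) (code (b, c))) (tree_sizeE (code b) (code c)).
  rewrite !sizeE; set N := (tree_size (code x) + (tree_size (code z) + _).+1).+1.
  have Hfold := size_fold x z (take n l).
  have Hr1 : r (tree_size (code x) + tree_size (code (take n l))) <= r N.
    by apply: (pol_homo Hr); have := size_take n l; rewrite /N; lia.
  have Hs : size (take n l) <= N.
    by have := size_seq (take n l); have := size_take n l; rewrite /N; lia.
  have := leq_mul Hs Hr1; have := size_drop n l.
  by move: (_ * r _) (N * r N) Hfold => u v; rewrite /N; lia.
have Hit : polytime (fun s => iter (tree_size (code s)) step s).
  by apply: (polytime_iter (q := fun n => n + n * r n) Hstep _ Hbound); pol.
apply: polytime_ext (polytime_fst (polytime_snd Hit)) => -[x [z l]].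
rewrite stepE /= take_oversize //.
rewrite [tree_size _](tree_sizeE (code x) (code (z, l))) (tree_sizeE (code z) (code l)).
have := size_seq l; lia.
Qed.

Lemma polytime_foldl (X Y Z : codedType) (g : X * (Z * Y) -> Z) (r : nat -> nat)
    (z : X -> Z) (l : X -> seq Y) : polytime g -> pol r ->
  (forall x z y, tree_size (code (g (x, (z, y)))) <=
     tree_size (code z) + r (tree_size (code x) + tree_size (code y))) ->
  polytime z -> polytime l ->
  polytime (fun x => foldl (fun z y => g (x, (z, y))) (z x) (l x)).
Proof.
move=> Hg Hr B Hz Hl.
have := polytime_comp (polytime_foldl_state Hg Hr B)
  (polytime_pair (polytime_id X) (polytime_pair Hz Hl)).
exact: polytime_ext.
Qed.

Lemma polytime_rev (X Y : codedType) (l : X -> seq Y) :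
  polytime l -> polytime (fun x => rev (l x)).
Proof.
move=> Hl; pose g (u : X * (seq Y * Y)) := u.2.2 :: u.2.1.
have Hg : polytime g.
  have P := @polytime_proj2 X (seq Y * Y)%type.
  exact: polytime_cons (polytime_snd P) (polytime_fst P).
have H := polytime_foldl (r := fun n => n.+1) Hg _ _ (polytime_const X [::]) Hl.
apply: polytime_ext (H _ _) => [x||x z y].
- rewrite /rev -[RHS]/(catrev (l x) [::]).
  by elim: (l x) [::] => //= y s IH z; rewrite -IH.
- by pol.
- by rewrite [tree_size _](tree_sizeE (code y) (code z)); lia.
Qed.

Lemma polytime_foldr (X Y Z : codedType) (g : X * (Y * Z) -> Z) (r : nat -> nat)
    (z : X -> Z) (l : X -> seq Y) : polytime g -> pol r ->
  (forall x y z, tree_size (code (g (x, (y, z)))) <=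
     tree_size (code z) + r (tree_size (code x) + tree_size (code y))) ->
  polytime z -> polytime l ->
  polytime (fun x => foldr (fun y z => g (x, (y, z))) (z x) (l x)).
Proof.
move=> Hg Hr B Hz Hl.
pose g' (u : X * (Z * Y)) := g (u.1, (u.2.2, u.2.1)).
have Hg' : polytime g'.
  have P := @polytime_proj2 X (Z * Y)%type.
  apply: polytime_comp Hg (polytime_pair (@polytime_proj1 _ _) _).
  exact: polytime_pair (polytime_snd P) (polytime_fst P).
have H := polytime_foldl Hg' Hr _ Hz (polytime_rev Hl).
by apply: polytime_ext (H _) => [x|x ? ?]; [rewrite foldl_rev | apply: B].
Qed.

Lemma polytime_all (X Y : codedType) (p : X * Y -> bool) (l : X -> seq Y) :
  polytime p -> polytime l -> polytime (fun x => all (fun y => p (x, y)) (l x)).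
Proof.
move=> Hp Hl; pose g (u : X * (Y * bool)) := p (u.1, u.2.1) && u.2.2.
have Hg : polytime g.
  have P := @polytime_proj2 X (Y * bool)%type.
  apply: polytime_and (polytime_snd P).
  exact: polytime_comp Hp (polytime_pair (@polytime_proj1 _ _) (polytime_fst P)).
have H := polytime_foldr (r := fun n => 3) Hg _ _ (polytime_const X true) Hl.
apply: polytime_ext (H _ _) => [x||x y z].
- by elim: (l x) => //= y s ->.
- by pol.
- by case: (g _); case: z; rewrite /tree_size /=; lia.
Qed.

Lemma polytime_has (X Y : codedType) (p : X * Y -> bool) (l : X -> seq Y) :
  polytime p -> polytime l -> polytime (fun x => has (fun y => p (x, y)) (l x)).
Proof.
move=> Hp Hl.
apply: polytime_ext (polytime_negb (polytime_all (polytime_negb Hp) Hl)) => x.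
by rewrite -has_predC; apply: eq_has => y /=; rewrite negbK.
Qed.

(** * From the raw input word to a coded list of symbols *)

Definition unary n := iter n (Br Lf) Lf.

Lemma unary_inj : injective unary.
Proof. by elim=> [|m IH] [|n] //= [/IH->]. Qed.

HB.instance Definition _ :=
  isCoded.Build symbol (inj_comp unary_inj (can_inj symbol_indexK)).

Lemma size_unary n : size (ser (unary n)) = (2 * n).+1.
Proof. by elim: n => //= n ->; lia. Qed.

Lemma size_code_symbol (a : symbol) : size (ser (code a)) <= 21.
Proof. by rewrite size_unary; case: a => [[]|[]||[]|[]|]. Qed.

Definition load_symbol : cmd sym :=
  foldr (fun (a : symbol) c => If 1 (pred1 (inl a)) (pushes 0 (inr true :: word (code a))) c)
    nop symbols.

Lemma does_load_symbol s a l : s 1 = inl a :: l ->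
  does load_symbol s 46 (upd s 0 (inr true :: word (code a) ++ s 0)).
Proof.
move=> E; have : a \in symbols by case: a {E} => [[]|[]||[]|[]|].
(* Pushing at most 22 symbols costs at most 24, and each of the 11 tests costs 2. *)
have -> : 46 = 24 + (size symbols).*2 by [].
have push : does (pushes 0 (inr true :: word (code a))) s 24
    (upd s 0 (inr true :: word (code a) ++ s 0)).
  refine (does_cong _ _ (does_pushes _ 0 (inr true :: word (code a)))) => //.
  by have := size_code_symbol a; rewrite /= size_map; lia.
rewrite /load_symbol; elim: symbols => [|b bs IH]; first by [].
rewrite inE [foldr _ _ _]/= [size _]/= doubleS !addnS => Ha; apply: does_if.
have -> : top (pred1 (inl b)) (s 1) = (a == b) by rewrite E.
case/predU1P: Ha => [Eab|/IH{}IH]; last by case: eqP => [<-|_] //; apply: does_leq push; lia.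
by rewrite Eab eqxx -Eab; apply: does_leq push; lia.
Qed.

Definition load_word : cmd sym :=
  Seq (move_rev 0 1)
    (Seq (Push 0 (inr false)) (While 1 predT (Seq load_symbol (Pop 1)))).

Lemma does_load_word s (w : seq symbol) : s 0 = map inl w -> s 1 = [::] ->
  does load_word s (53 * size w + 3) (upd s 0 (word (code w))).
Proof.
move=> E0 E1.
have loop u (v : seq symbol) s1 : s1 1 = map inl u -> s1 0 = word (code v) ->
    does (While 1 predT (Seq load_symbol (Pop 1))) s1 (49 * size u + 1)
      (upd (upd s1 1 [::]) 0 (word (code (catrev u v)))).
  elim: u v s1 => [|a u IH] v s1 H1 H0.
    by apply: does_cong (does_while_false _ _); rewrite ?H1 //; store.
  have -> : 49 * size (a :: u) + 1 = (46 + 1 + (49 * size u + 1)).+2 by rewrite /=; lia.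
  apply: does_while_true; first by rewrite H1.
    exact: does_seq (does_load_symbol H1) (does_pop _ _).
  apply: does_eq (IH (a :: v) _ _ _); first by store.
    by eval_store; rewrite H1.
  by eval_store; rewrite H0 /= map_cat.
have -> : 53 * size w + 3 = (4 * size w + 1) + (1 + (49 * size w + 1)) by lia.
apply: (does_step (upd (upd s 0 [::]) 1 (map inl (rev w))) (@does_move_rev _ 0 1 _)) => //.
- by rewrite E0 size_map.
- by store; rewrite E0 E1 catrevE cats0 map_rev.
apply: (does_step (upd (upd s 0 [:: inr false]) 1 (map inl (rev w))) (does_push _ _ _)) => //.
- by store.
apply: does_cong (loop (rev w) [::] _ _ _) => //.
- by rewrite size_rev.
- by store; rewrite catrevE revK cats0.
Qed.

Lemma size_code_word (w : seq symbol) : tree_size (code w) <= 1 + 22 * size w.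
Proof.
elim: w => [|a w IH] //; rewrite [tree_size _](tree_sizeE (code a) (code w)) [size _]/=.
have : tree_size (code a) <= 21 := size_code_symbol a; lia.
Qed.

Theorem class_P_polytime (d : seq symbol -> bool) (L : seq symbol -> Prop) :
  polytime d -> (forall w, d w <-> L w) -> class_P L.
Proof.
move=> [c [k [p [Hp H]]]] HL.
apply: (@class_P_run _ (Seq load_word c)
  (fun n => (53 * n + 3) + p (1 + 22 * n))) => [|w]; first by pol.
have size_w := size_code_word w.
pose s : store sym := fun i => if i == 0 then map inl w else [::].
have [_ /(_ (upd s 0 (word (code w))))] := H w.
move=> /(_ erefl) [|m le_m R]; first
  by move=> i hi; rewrite /upd /s; case: (i =P 0) => [Ei|//]; rewrite Ei in hi.
have [n le_n Rn] := @does_load_word s w erefl erefl.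
exists (n + m), (upd (upd s 0 (word (code w))) 0 (word (code (d w)))), (d w).
(* The word of a boolean starts with that boolean, which is the bit that the machine reads as its
   verdict. *)
exists (if d w then word Lf ++ word Lf else [::]).
split=> //; first exact: run_seq Rn R.
- apply: leq_add => //; exact: leq_trans le_m (pol_homo Hp size_w).
- by case: (d w).
Qed.

(** * Labelled executions of a process block *)

(* [Some (p, f, g)] records whether the distinguished position and the two side
   conditions have been met; [None] means that the distinguished position has
   been chosen twice. *)
Definition weight := option (bool * bool * bool).

Definition wone : weight := Some (false, false, false).

Definition wadd (v w : weight) : weight :=
  if (v, w) is (Some (p, f, g), Some (p', f', g')) then
    if p && p' then None else Some (p || p', f || f', g || g')
  else None.

Fact waddA : associative wadd.
Proof. by do 3![case=> [[[[] []] []]|]]. Qed.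
Fact waddC : commutative wadd.
Proof. by do 2![case=> [[[[] []] []]|]]. Qed.
Fact wadd1 : left_id wone wadd.
Proof. by case=> [[[[] []] []]|]. Qed.
HB.instance Definition _ := Monoid.isComLaw.Build weight wone wadd waddA waddC wadd1.

Section Labels.
Variables (pat : finType) (n : nat) (letter : Type).
Notation seg := 'I_n.
Variables (fits : pat -> seg -> letter -> bool) (gain : pat -> seg -> letter -> weight).
Variable read : task -> letter.

(** In a key [(c, p, q, w)] the segments [p] and [q] only bound the labels and need not be attained;
    thus components of AND share an interval, and components of SEQ meet at a common segment. *)
Definition value := {set pat * seg * seg * weight}.

Definition leaf_value (x : letter) : value :=
  [set k : pat * seg * seg * weight | let: (c, p, q, w) := k in
    [exists l : seg, [&& p <= l <= q, fits c l x & w == gain c l x]]].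

Definition unit_value (op : operator) : value :=
  if op is XOR then set0
  else [set k : pat * seg * seg * weight | let: (c, p, q, w) := k in (p <= q) && (w == wone)].

Definition comb_value (op : operator) (A B : value) : value :=
  match op with
  | SEQ => [set k : pat * seg * seg * weight | let: (c, p, q, w) := k in
      [exists m : seg, exists w1 : weight, exists w2 : weight,
        [&& (c, p, m, w1) \in A, (c, m, q, w2) \in B & w == wadd w1 w2]]]
  | XOR => A :|: B
  | AND => [set k : pat * seg * seg * weight | let: (c, p, q, w) := k in
      [exists w1 : weight, exists w2 : weight,
        [&& (c, p, q, w1) \in A, (c, p, q, w2) \in B & w == wadd w1 w2]]]
  end.

Definition node_value op (vs : seq value) : value :=
  foldr (comb_value op) (unit_value op) vs.

Fixpoint block_value (B : block) : value :=
  match B with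
  | Task s => leaf_value (read s)
  | Node op Bs => node_value op (map block_value Bs)
  end.

Variable c : pat.

(** Labels belong to tasks, not to positions: they survive reordering by an interleaving, and
    labellings of blocks with disjoint tasks can be glued. *)
Definition labelled (lam : task -> seg) (p q : seg) (e : seq task) : bool :=
  sorted (relpre lam leq) e && all (fun s => (p <= lam s <= q) && fits c (lam s) (read s)) e.

Definition gains (lam : task -> seg) (e : seq task) : weight :=
  \big[wadd/wone]_(s <- e) gain c (lam s) (read s).

Definition feasible (E : seq (seq task)) (p q : seg) (w : weight) : Prop :=
  exists e lam, [/\ e \in E, labelled lam p q e & w = gains lam e].

Lemma labelled_eq lam mu p q e : {in e, lam =1 mu} -> labelled lam p q e = labelled mu p q e.
Proof.
move=> E; rewrite /labelled; congr (_ && _); last first.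
  by apply: eq_in_all => s /E Es; rewrite Es.
by apply: (@eq_in_sorted _ [in e]) => [s t /E Es /E Et /=|]; rewrite ?Es ?Et //; apply/allP.
Qed.

Lemma gains_eq lam mu e : {in e, lam =1 mu} -> gains lam e = gains mu e.
Proof. by move=> E; apply: eq_big_seq => s /E ->. Qed.

Lemma gains_cat lam e f : gains lam (e ++ f) = wadd (gains lam e) (gains lam f).
Proof. exact: big_cat. Qed.

Lemma mem_choicesP (T : eqType) (E : seq (seq T)) Es es :
  reflect (exists e f, [/\ e \in E, f \in choices Es & es = e :: f])
    (es \in choices (E :: Es)).
Proof.
apply: (iffP allpairsP) => [[[e f] /= [? ? ->]]|[e [f [? ? ->]]]]; first by exists e, f.
by exists (e, f).
Qed.

Lemma mem_executions B e : e \in executions B -> {subset e <= tasks B}.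
Proof.
elim/block_rect_nested: B e => [s|op Bs IH] e /=; first by rewrite inE => /eqP->.
have IHs es : es \in choices (map executions Bs) ->
    {subset flatten es <= flatten (map tasks Bs)}.
  elim: Bs IH es => [_|B Bs IHBs [IHB /IHBs{}IH]] es; first by rewrite inE => /eqP->.
  case/mem_choicesP=> f [g [/IHB Hf /IH Hg ->]] s /=.
  by rewrite !mem_cat => /orP[/Hf->|/Hg->]; rewrite ?orbT.
case: op.
- by case/mapP=> es /IHs H ->.
- move=> He s Hs; elim: Bs IH He {IHs} => //= B Bs IHBs [IHB /IHBs{}IH].
  by rewrite !mem_cat => /orP[/IHB->|/IH->]; rewrite ?orbT.
- case/flattenP=> _ /mapP[es /IHs H ->]; rewrite mem_filter mem_permutations => /andP[_].
  by move/perm_mem=> E s; rewrite E => /H.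
Qed.

Lemma disjoint_flatten (B : block) Bs : uniq (tasks B ++ flatten (map tasks Bs)) ->
  forall s, s \in tasks B -> s \notin flatten (map tasks Bs).
Proof.
rewrite cat_uniq => /and3P[_ /hasPn H _] s Hs.
by apply: contraL Hs => /H.
Qed.

Let lam_trans (lam : task -> seg) : transitive (relpre lam leq).
Proof. by move=> y x z; apply: leq_trans. Qed.

Lemma labelled_cat lam p q e f : labelled lam p q (e ++ f) =
  [&& labelled lam p q e, labelled lam p q f & allrel (relpre lam leq) e f].
Proof.
rewrite /labelled !sorted_pairwise // pairwise_cat all_cat.
by do ![case: (all _ _) | case: (pairwise _ _) | case: (allrel _ _ _)].
Qed.

Lemma labelled_widen lam (p p' q q' : seg) e :
  p' <= p -> q <= q' -> labelled lam p q e -> labelled lam p' q' e.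
Proof.
move=> lep leq' /andP[Hs Ha]; rewrite /labelled Hs /=.
by apply: sub_all Ha => s /andP[/andP[h1 h2] ->]; rewrite (leq_trans lep) ?(leq_trans h2).
Qed.

Lemma labelled_join lam (p m q : seg) e f : p <= m -> m <= q ->
  labelled lam p m e -> labelled lam m q f -> labelled lam p q (e ++ f).
Proof.
move=> pm mq He Hf; rewrite labelled_cat (labelled_widen _ mq He) //.
rewrite (labelled_widen pm _ Hf) //=; apply/allrelP => s t.
case/andP: He => _ /allP He; case/andP: Hf => _ /allP Hf.
move=> /He /andP[/andP[_ hs] _] /Hf /andP[/andP[ht _] _].
exact: leq_trans hs ht.
Qed.

(** The meeting segment is the label of the last task of [e], or [p] when [e] is empty. *)
Lemma labelled_split lam (p q : seg) e f : p <= q -> labelled lam p q (e ++ f) ->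
  exists m : seg, [/\ p <= m <= q, labelled lam p m e & labelled lam m q f].
Proof.
case/lastP: e => [|e s] pq; first by exists p; rewrite leqnn.
rewrite labelled_cat => /and3P[He Hf /allrelP Hef].
have /andP[Hs Ha] := He.
have Hms : p <= lam s <= q.
  by move/allP: Ha => /(_ s); rewrite mem_rcons inE eqxx => /(_ isT) /andP[].
exists (lam s); split=> //.
  rewrite /labelled Hs; apply/allP => t Ht.
  have /andP[/andP[-> _] ->] := allP Ha t Ht; rewrite andbT /=.
  move: Hs Ht; rewrite sorted_pairwise // -cats1 pairwise_cat => /and3P[/allrelP H _ _].
  rewrite mem_cat inE => /orP[Ht|/eqP-> //].
  by apply: (H t s); rewrite ?inE.
case/andP: Hf => Hfs Hfa; rewrite /labelled Hfs; apply/allP => t Ht.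
have /andP[/andP[_ ->] ->] := allP Hfa t Ht; rewrite !andbT.
by apply: (Hef s t); rewrite // mem_rcons inE eqxx.
Qed.

Definition glue (e : seq task) (lam mu : task -> seg) : task -> seg :=
  fun s => if s \in e then lam s else mu s.

Lemma glueL e lam mu (f : seq task) : {subset f <= e} -> {in f, glue e lam mu =1 lam}.
Proof. by move=> H s /H Hs; rewrite /glue Hs. Qed.

Lemma glueR e lam mu (f : seq task) :
  (forall s, s \in f -> s \notin e) -> {in f, glue e lam mu =1 mu}.
Proof. by move=> H s /H Hs; rewrite /glue (negbTE Hs). Qed.

(** A node without components can have the empty execution, which every labelling fits; hence
    [p <= q] is stated separately. *)
Definition correct (B : block) := forall p q w,
  (c, p, q, w) \in block_value B <-> feasible (executions B) p q w /\ p <= q.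

Lemma mem_choices_executions Bs es : es \in choices (map executions Bs) ->
  {subset flatten es <= flatten (map tasks Bs)}.
Proof.
elim: Bs es => [|B Bs IHBs] es; first by rewrite inE => /eqP->.
case/mem_choicesP=> f [g [/mem_executions Hf /IHBs Hg ->]] s /=.
by rewrite !mem_cat => /orP[/Hf->|/Hg->]; rewrite ?orbT.
Qed.

Lemma node_value_SEQ Bs : foldr (fun B => and (correct B)) True Bs ->
  uniq (flatten (map tasks Bs)) -> forall p q w,
  (c, p, q, w) \in node_value SEQ (map block_value Bs) <->
  p <= q /\ exists es lam, [/\ es \in choices (map executions Bs),
    labelled lam p q (flatten es) & w = gains lam (flatten es)].
Proof.
elim: Bs => [_ _|B Bs IH [HB /IH{}IH]] /= => [|/[dup] Hdis].
  move=> p q w; rewrite inE; split=> [/andP[pq /eqP->]|[pq [es [lam [/[!inE]/eqP-> _ ->]]]]].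
    by split=> //; exists [::], (fun=> p); rewrite inE /gains big_nil.
  by rewrite pq /gains big_nil.
rewrite cat_uniq => /and3P[_ _ /IH{}IH] p q w; rewrite inE; split.
  case/existsP=> m /existsP[w1 /existsP[w2 /and3P[/HB[[e [lam [He Hl E1]]] pm] H2 /eqP->]]].
  have [mq [es [mu [Hes Hmu E2]]]] := (IH _ _ _).1 H2.
  split; first exact: leq_trans pm mq.
  (* No task of [B] occurs in the other components, so both labellings are kept. *)
  pose nu := glue (tasks B) lam mu.
  have nuL : {in e, nu =1 lam} by apply/glueL/mem_executions.
  have nuR : {in flatten es, nu =1 mu}.
    apply: glueR => s /(mem_choices_executions Hes).
    by apply: contraL => /(disjoint_flatten Hdis).
  exists (e :: es), nu; split=> /=.
  - by apply/mem_choicesP; exists e, es.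
  - by apply: (labelled_join pm mq); rewrite ?(labelled_eq _ _ nuL) ?(labelled_eq _ _ nuR).
  - by rewrite gains_cat (gains_eq nuL) (gains_eq nuR) -E1 -E2.
case=> pq [_ [lam [/mem_choicesP[e [es [He Hes ->]]] /= Hl ->]]].
have [m [/andP[pm mq] H1 H2]] := labelled_split pq Hl.
apply/existsP; exists m; apply/existsP; exists (gains lam e); apply/existsP.
exists (gains lam (flatten es)); rewrite gains_cat eqxx andbT; apply/andP; split.
  by apply/HB; split=> //; exists e, lam.
by apply/IH; split=> //; exists es, lam.
Qed.

Lemma node_value_XOR Bs : foldr (fun B => and (correct B)) True Bs -> forall p q w,
  (c, p, q, w) \in node_value XOR (map block_value Bs) <->
  feasible (flatten (map executions Bs)) p q w /\ p <= q.
Proof.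
elim: Bs => [_|B Bs IH [HB /IH{}IH]] p q w /=.
  by rewrite inE; split=> // -[[e [lam []]]].
rewrite inE; split.
  case/orP=> [/HB|/IH] [[e [lam [He Hl E]]] pq]; split=> //; exists e, lam.
    by rewrite mem_cat He.
  by rewrite mem_cat He orbT.
case=> -[e [lam [He Hl E]]] pq; move: He; rewrite mem_cat => /orP[He|He].
  by apply/orP; left; apply/HB; split=> //; exists e, lam.
by apply/orP; right; apply/IH; split=> //; exists e, lam.
Qed.

Lemma node_value_AND Bs : foldr (fun B => and (correct B)) True Bs ->
  uniq (flatten (map tasks Bs)) -> forall p q w,
  (c, p, q, w) \in node_value AND (map block_value Bs) <->
  p <= q /\ exists es lam, [/\ es \in choices (map executions Bs),
    all (labelled lam p q) es & w = gains lam (flatten es)].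
Proof.
elim: Bs => [_ _|B Bs IH [HB /IH{}IH]] /= => [|/[dup] Hdis].
  move=> p q w; rewrite inE; split=> [/andP[pq /eqP->]|[pq [es [lam [/[!inE]/eqP-> _ ->]]]]].
    by split=> //; exists [::], (fun=> p); rewrite inE /gains big_nil.
  by rewrite pq /gains big_nil.
rewrite cat_uniq => /and3P[_ _ /IH{}IH] p q w; rewrite inE; split.
  case/existsP=> w1 /existsP[w2 /and3P[/HB[[e [lam [He Hl E1]]] pq] H2 /eqP->]].
  have [_ [es [mu [Hes Hmu E2]]]] := (IH _ _ _).1 H2.
  split=> //.
  pose nu := glue (tasks B) lam mu.
  have nuL : {in e, nu =1 lam} by apply/glueL/mem_executions.
  have nuR : {in flatten es, nu =1 mu}.
    apply: glueR => s /(mem_choices_executions Hes).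
    by apply: contraL => /(disjoint_flatten Hdis).
  exists (e :: es), nu; split=> /=.
  - by apply/mem_choicesP; exists e, es.
  - rewrite (labelled_eq _ _ nuL) Hl; apply/allP => f Hf.
    have sub : {subset f <= flatten es} by move=> s Hs; apply/flattenP; exists f.
    rewrite (@labelled_eq nu mu); first exact: (allP Hmu).
    by move=> s /sub /nuR.
  - by rewrite gains_cat (gains_eq nuL) (gains_eq nuR) -E1 -E2.
case=> pq [_ [lam [/mem_choicesP[e [es [He Hes ->]]] /= /andP[Hl Hls] ->]]].
apply/existsP; exists (gains lam e); apply/existsP.
exists (gains lam (flatten es)); rewrite gains_cat eqxx andbT; apply/andP; split.
  by apply/HB; split=> //; exists e, lam.
by apply/IH; split=> //; exists es, lam.
Qed.

(* A stable sort by label merges labelled executions of the components of an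
   AND block into one labelled interleaving. *)
Lemma interleavings_labelled p q w Es :
  (exists es lam, [/\ es \in choices Es, all (labelled lam p q) es
     & w = gains lam (flatten es)]) <->
  feasible (flatten [seq interleavings es | es <- choices Es]) p q w.
Proof.
split=> [[es [lam [Hes Hl ->]]]|[e [lam [/flattenP[_ /mapP[es Hes ->]]]]]].
  exists (sort (relpre lam leq) (flatten es)), lam.
  have tot : total (relpre lam leq) by move=> s t; apply: leq_total.
  have Hp : perm_eq (sort (relpre lam leq) (flatten es)) (flatten es) by rewrite perm_sort.
  split; last exact/esym/perm_big.
    apply/flattenP; exists (interleavings es); first by apply: map_f.
    rewrite mem_filter mem_permutations Hp andbT; apply/allP => e He.
    have /andP[Hs _] := allP Hl e He.
    (* [e] is sorted by label, hence equal to its own sort, and stable sorting preserves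
       subsequences. *)
    rewrite -(sorted_sort (@lam_trans lam) Hs); apply: subseq_sort => //.
    elim: es He {Hes Hl Hp} => //= f es IH; rewrite inE => /predU1P[->|/IH H].
      exact: prefix_subseq.
    exact: subseq_trans H (suffix_subseq _ _).
  rewrite /labelled sort_sorted //= (perm_all _ Hp); apply/allP => s /flattenP[e He Hse].
  by have /andP[_ /allP] := allP Hl e He; apply.
rewrite mem_filter mem_permutations => /andP[Hsub Hp] /andP[Hs Ha] ->.
exists es, lam; split=> //; last exact: perm_big.
apply/allP => f Hf; have Hff := allP Hsub f Hf.
rewrite /labelled (subseq_sorted (@lam_trans lam) Hff Hs).
by apply/allP => s Hsf; apply: (allP Ha); apply: (mem_subseq Hff).
Qed.

Theorem block_value_correct B : uniq (tasks B) -> correct B.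
Proof.
elim/block_rect_nested: B => [s _|op Bs IH /= U] p q w.
  rewrite inE; split.
    case/existsP=> l /and3P[/andP[pl lq] Hf /eqP->]; split; last exact: leq_trans pl lq.
    exists [:: s], (fun=> l); split; rewrite ?inE //; last by rewrite /gains big_seq1.
    by rewrite /labelled /= pl lq Hf.
  case=> -[e [lam [/[!inE]/eqP-> /andP[_ /=/andP[/andP[H Hf] _]] ->]]] _.
  by apply/existsP; exists (lam s); rewrite H Hf /gains big_seq1 eqxx.
have {}IH : foldr (fun B => and (correct B)) True Bs.
  elim: Bs IH U => //= B Bs IHBs [IHB IH].
  by rewrite cat_uniq => /and3P[/IHB HB _ /(IHBs IH)].
case: op => /=.
- split=> [/(node_value_SEQ IH U)[pq [es [lam [Hes Hl ->]]]]|].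
    by split=> //; exists (flatten es), lam; split=> //; apply: map_f.
  case=> -[_ [lam [/mapP[es Hes ->] Hl ->]]] pq.
  by apply/(node_value_SEQ IH U); split=> //; exists es, lam.
- exact: node_value_XOR.
- split=> [/(node_value_AND IH U)[pq /interleavings_labelled H]|[/interleavings_labelled H pq]].
    by split.
  by apply/(node_value_AND IH U).
Qed.

End Labels.

(** * Violation patterns *)

(* What the annotation of a task says about an obligation: whether it contains
   the requirement, its complement, the trigger, the deadline, its complement. *)
Definition letter := (bool * bool * bool * bool * bool)%type.

Definition lR (x : letter) := x.1.1.1.1.
Definition lN (x : letter) := x.1.1.1.2.
Definition lT (x : letter) := x.1.1.2.
Definition lD (x : letter) := x.1.2.
Definition lE (x : letter) := x.2.

Definition any (x : letter) := true.
Definition none (x : letter) := false.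
Definition noR x := ~~ lR x.
Definition noD x := ~~ lD x.
Definition noE x := ~~ lE x.
Definition noRE x := noR x && noE x.
Definition with_T (p : letter -> bool) x := lT x && p x.

(* Each violation pattern cuts an execution into seven consecutive segments and
   prescribes what its tasks may say in each of them; the segment 3 consists of
   the task that triggers the violated obligation. The patterns 0, 1 and 2 violate
   achievement obligations: the deadline is set after the trigger (0), or still
   holds at the trigger and was set after (1) or before (2) the requirement was
   lost. The patterns 3, 4 and 5 violate maintenance obligations: the requirement
   fails at the trigger (3), or is lost later, while the deadline was never set
   (4) or was cancelled before the trigger (5). *)
Definition pattern_classes (c : nat) : seq (letter -> bool) :=
  match c with
  | 0 => [:: any; none; noR; with_T noR; noR; none; any]
  | 1 => [:: any; noR; noRE; with_T noRE; none; none; any]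
  | 2 => [:: any; noE; noRE; with_T noRE; none; none; any]
  | 3 => [:: any; none; noR; with_T noR; none; none; any]
  | 4 => [:: noD; none; none; with_T noD; noD; lN; any]
  | _ => [:: any; none; noD; with_T noD; noD; lN; any]
  end.

Definition pattern_fits (c l : nat) (x : letter) : bool :=
  nth none (pattern_classes c) l x.

(* Two tasks, beside the trigger, have to occur in the segments of a pattern: they
   meet the conditions [pattern_fst] and [pattern_snd]. *)
Definition pattern_fst (c l : nat) (x : letter) : bool :=
  match c with
  | 0 | 2 | 3 => (1 < l < 4) && lN x
  | 1 => (0 < l < 4) && lN x
  | 4 => l == 3
  | _ => (1 < l < 4) && lE x
  end.

Definition pattern_snd (c l : nat) (x : letter) : bool :=
  match c with
  | 0 => (2 < l < 5) && lD x
  | 1 => (1 < l < 4) && lD x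
  | 2 => (0 < l < 4) && lD x
  | 3 => l == 3
  | _ => l == 5
  end.

Definition achieving (c : nat) := c < 3.

(** * Patterns and violations on a sequence of letters *)

Section Positions.
Variables (n : nat) (x : nat -> letter).

Definition matches (c : nat) : Prop := exists f : nat -> nat,
  [/\ forall i j, i <= j -> j < n -> f i <= f j,
      forall i, i < n -> pattern_fits c (f i) (x i),
      exists2 i, i < n & f i = 3 /\ forall j, j < n -> f j = 3 -> j = i,
      exists2 i, i < n & pattern_fst c (f i) (x i)
    & exists2 i, i < n & pattern_snd c (f i) (x i)].

(** When [P] and [Q] tell that a task sets a literal or its complement, this says that the literal
    holds in the state after position [j]. *)
Definition last_is (P Q : letter -> bool) (j : nat) : Prop :=
  exists2 b, b <= j & P (x b) /\ forall k, b < k <= j -> ~~ Q (x k).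

Hypothesis exclRN : forall i, i < n -> ~~ (lR (x i) && lN (x i)).
Hypothesis exclDE : forall i, i < n -> ~~ (lD (x i) && lE (x i)).

Lemma last_is_excl (P Q : letter -> bool) j : (forall i, i <= j -> ~~ (P (x i) && Q (x i))) ->
  last_is P Q j -> ~ last_is Q P j.
Proof.
move=> ex [b bj [Pb Hb]] [d dj [Qd Hd]]; case: (ltngtP b d) => bd.
- by have := Hb d; rewrite bd dj Qd => /(_ isT).
- by have := Hd b; rewrite bd bj Pb => /(_ isT).
- by have := ex b bj; rewrite Pb bd Qd.
Qed.

Lemma last_is_none (P Q : letter -> bool) j :
  (forall i, i <= j -> ~~ P (x i)) -> ~ last_is P Q j.
Proof. by move=> H [b /H/negP nP [/nP]]. Qed.

(** A literal that does not hold has either been cancelled since it was last set, or has never been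
    set. The two cases lead to different patterns. *)
Lemma not_last_is (P Q : letter -> bool) j : ~ last_is P Q j ->
  last_is Q P j \/ forall i, i <= j -> ~~ P (x i).
Proof.
elim: j => [|j IH] H.
  case HP : (P (x 0)); last by right=> -[|] //; rewrite HP.
  by case: H; exists 0 => //; split=> // k; case: k.
case HP : (P (x j.+1)).
  by case: H; exists j.+1 => //; split=> // k; lia.
case HQ : (Q (x j.+1)).
  by left; exists j.+1 => //; split=> // k; lia.
case: IH => [[b bj [Pb Hb]]|[b bj [Qb Hb]]|Hno].
- case: H; exists b; first lia; split=> // k /andP[bk]; rewrite leq_eqVlt => /predU1P[->|kj].
    by rewrite HQ.
  by apply: Hb; rewrite bk.
- left; exists b; first lia; split=> // k /andP[bk]; rewrite leq_eqVlt => /predU1P[->|kj].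
    by rewrite HP.
  by apply: Hb; rewrite bk.
- right=> i; rewrite leq_eqVlt => /predU1P[->|]; [by rewrite HP|exact: Hno].
Qed.

Lemma last_is_here (P Q : letter -> bool) j : P (x j) -> last_is P Q j.
Proof. by exists j => //; split=> // k; lia. Qed.

(** A finite certificate of non-compliance: [k'] is a position where the deadline holds and the
    requirement still has not, or one where the requirement fails before the deadline could release
    it. That such a position exists relies on the deadline holding at the end. *)
Definition violation (k : kind) : Prop :=
  exists i k', [/\ i <= k' < n, lT (x i) &
    match k with
    | Achievement => last_is lD lE k' /\ forall j, i <= j <= k' -> ~ last_is lR lN j
    | Maintenance => ~ last_is lR lN k' /\ forall j, i <= j < k' -> ~ last_is lD lE j
    end].

Let exclNR i : i < n -> ~~ (lN (x i) && lR (x i)).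
Proof. by rewrite andbC; apply: exclRN. Qed.

Let exclED i : i < n -> ~~ (lE (x i) && lD (x i)).
Proof. by rewrite andbC; apply: exclDE. Qed.

Section Matching.
Variables (c : nat) (f : nat -> nat) (i : nat).
Hypothesis mono : forall i j, i <= j -> j < n -> f i <= f j.
Hypothesis fit : forall i, i < n -> pattern_fits c (f i) (x i).
Hypotheses (i_n : i < n) (fi : f i = 3) (Ui : forall j, j < n -> f j = 3 -> j = i).

(** Only the trigger [i] has label 3, so monotonicity places all smaller labels before it. *)
Let before a : a < n -> f a < 4 -> a <= i.
Proof.
move=> a_n fa; rewrite leqNgt; apply/negP => lt_ia.
by have := mono (ltnW lt_ia) a_n; rewrite fi => h; have := Ui a_n; lia.
Qed.

Let after a : a < n -> 2 < f a -> i <= a.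
Proof.
move=> a_n fa; rewrite leqNgt; apply/negP => lt_ia.
by have := mono (ltnW lt_ia) i_n; rewrite fi => h; have := Ui a_n; lia.
Qed.

Let within (P : letter -> bool) lo hi a b :
  (forall l y, lo <= l <= hi -> pattern_fits c l y -> P y) ->
  lo <= f a -> f b <= hi -> b < n -> forall k, a <= k <= b -> P (x k).
Proof.
move=> H fa fb bn k /andP[ak kb].
have kn : k < n by apply: leq_ltn_trans bn.
apply: (H (f k)); last exact: fit.
by rewrite (leq_trans fa (mono ak kn)) (leq_trans (mono kb bn) fb).
Qed.

Let trigger_here : (forall y, pattern_fits c 3 y -> lT y) -> lT (x i).
Proof. by apply; rewrite -fi; apply: fit. Qed.

Lemma match0_violation a b : c = 0 -> a < n -> b < n ->
  pattern_fst 0 (f a) (x a) -> pattern_snd 0 (f b) (x b) -> violation Achievement.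
Proof.
move=> Ec an bn /andP[fa Na] /andP[fb Db]; subst c.
have ai : a <= i by apply: before => //; lia.
have ib : i <= b by apply: after => //; lia.
have nR : forall k, a <= k <= b -> noR (x k).
  apply: (@within _ 2 4) => //; try lia.
  by case=> [|[|[|[|[|]]]]] // y _ /andP[].
exists i, b; split; first lia.
  by apply: trigger_here => y /andP[].
split; first exact: last_is_here.
move=> j ij; apply: (@last_is_excl lN); first by move=> k kj; apply: exclNR; lia.
by exists a; [lia | split=> // k ak; apply: nR; lia].
Qed.

Lemma match12_violation a b : c = 1 \/ c = 2 -> a < n -> b < n ->
  pattern_fst c (f a) (x a) -> pattern_snd c (f b) (x b) -> violation Achievement.
Proof.
move=> Ec an bn Fa Fb.
(* [c.-1] and, below, [2 - c] are the lower bounds in [pattern_fst] and [pattern_snd], uniformly for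
   the patterns 1 and 2. *)
have [Na fa] : lN (x a) /\ (c.-1 < f a < 4).
  by case: Ec Fa => -> /andP[].
have [Db fb] : lD (x b) /\ (2 - c < f b < 4).
  by case: Ec Fb => -> /andP[].
have ai : a <= i by apply: before => //; lia.
have bi : b <= i by apply: before => //; lia.
have nR : forall k, a <= k <= i -> noR (x k).
  apply: (@within _ c 3); rewrite ?fi //; try lia.
  by case: Ec => ->; case=> [|[|[|[|]]]] // y _; do ?[case/andP=> // _]; case/andP.
have nE : forall k, b <= k <= i -> noE (x k).
  apply: (@within _ (3 - c) 3); rewrite ?fi //; try lia.
  by case: Ec => ->; case=> [|[|[|[|]]]] // y _; do ?[case/andP=> // _]; case/andP.
exists i, i; split; first by rewrite leqnn.
  by apply: trigger_here => y; case: Ec => -> /andP[].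
split; first by exists b => //; split=> // k bk; apply: nE; lia.
move=> j ij; apply: (@last_is_excl lN); first by move=> k kj; apply: exclNR; lia.
by exists a; [lia | split=> // k ak; apply: nR; lia].
Qed.

Lemma match3_violation a : c = 3 -> a < n ->
  pattern_fst 3 (f a) (x a) -> violation Maintenance.
Proof.
move=> Ec an /andP[fa Na]; subst c.
have ai : a <= i by apply: before => //; lia.
have nR : forall k, a <= k <= i -> noR (x k).
  apply: (@within _ 2 3); rewrite ?fi //; try lia.
  by case=> [|[|[|[|]]]] // y _; case/andP.
exists i, i; split; first by rewrite leqnn.
  by apply: trigger_here => y /andP[].
split; last by move=> j; lia.
apply: (@last_is_excl lN); first by move=> k kj; apply: exclNR; lia.
by exists a; [lia | split=> // k ak; apply: nR; lia].
Qed.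

Lemma match45_violation b : c = 4 \/ c = 5 -> b < n ->
  pattern_fst c (f b) (x b) -> (exists2 k, k < n & f k == 5) -> violation Maintenance.
Proof.
move=> Ec bn Fb [k0 k0n fk0].
have exk : exists k, (k < n) && (f k == 5) by exists k0; rewrite k0n.
(* Segment 5 may contain several tasks. The violation is at the first of them, as all earlier labels
   are below 5 and none of these tasks interferes with the deadline being false. *)
case: (ex_minnP exk) => k /andP[kn /eqP fk] min_k.
have Nk : lN (x k) by have := fit kn; rewrite fk; case: Ec => ->.
have ik : i < k.
  have : i <= k by apply: after => //; lia.
  by rewrite leq_eqVlt => /predU1P[Eik|//]; rewrite -Eik fi in fk.
have lt5 j : j < k -> f j < 5.
  move=> jk; have := mono (ltnW jk) kn; rewrite fk leq_eqVlt ltnS.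
  by case/orP=> [fj|//]; have := min_k j; rewrite (ltn_trans jk kn) fj => /(_ isT); lia.
exists i, k; split; first by rewrite kn ltnW.
  by apply: trigger_here => y; case: Ec => -> /andP[].
split.
  apply: (@last_is_excl lN); last exact: last_is_here.
  by move=> j jk; apply: exclNR; lia.
move=> j /andP[ij jk]; have jn : j < n by lia.
case: Ec Fb => Ec Fb.
  apply: last_is_none => l lj.
  have : noD (x l).
    apply: (@within _ 0 4 0 j) => //; last by have := lt5 j jk; lia.
    by rewrite Ec; case=> [|[|[|[|[|]]]]] // y _; case/andP.
  by [].
rewrite Ec in Fb; move: Fb => /andP[fb Eb].
have bi : b <= i by apply: before => //; lia.
apply: (@last_is_excl lE); first by move=> l lj; apply: exclED; lia.
exists b; first lia; split=> // l bl.
have : noD (x l).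
  apply: (@within _ 2 4 b j) => //; try lia; last by have := lt5 j jk; lia.
  by rewrite Ec; case=> [|[|[|[|[|]]]]] // y _; case/andP.
by [].
Qed.

End Matching.

Lemma matches_violation c : c < 6 -> matches c ->
  violation (if achieving c then Achievement else Maintenance).
Proof.
move=> c6 [f [mono fit [i i_n [fi Ui]] [a a_n Fa] [b b_n Fb]]].
case: c c6 fit Fa Fb => [|[|[|[|[|[|//]]]]]] _ fit Fa Fb.
- exact: (match0_violation mono fit i_n fi Ui erefl a_n b_n Fa Fb).
- exact: (match12_violation mono fit i_n fi Ui (or_introl erefl) a_n b_n Fa Fb).
- exact: (match12_violation mono fit i_n fi Ui (or_intror erefl) a_n b_n Fa Fb).
- exact: (match3_violation mono fit i_n fi Ui erefl a_n Fa).
- apply: (match45_violation mono fit i_n fi Ui (or_introl erefl) a_n Fa); by exists b.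
- apply: (match45_violation mono fit i_n fi Ui (or_intror erefl) a_n Fa); by exists b.
Qed.

(* [p1] and [p2] start the segments 1 and 2, [i] is the segment 3, and [p4], [p5]
   are where the segments 4 and 5 end. *)
Definition cut p1 p2 i p4 p5 j : nat :=
  if j < p1 then 0 else if j < p2 then 1 else if j < i then 2 else if j == i then 3
  else if j < p4 then 4 else if j < p5 then 5 else 6.

Lemma cut_homo p1 p2 i p4 p5 j k : p1 <= p2 -> p2 <= i -> i < p4 -> p4 <= p5 -> j <= k ->
  cut p1 p2 i p4 p5 j <= cut p1 p2 i p4 p5 k.
Proof. by rewrite /cut => ? ? ? ? ?; do ![case: ifP => ?]; lia. Qed.

Lemma cut_eq3 p1 p2 i p4 p5 j : cut p1 p2 i p4 p5 j = 3 -> j = i.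
Proof. by rewrite /cut; do ![case: ifP => //]; lia. Qed.

Lemma cutE p1 p2 i p4 p5 : p1 <= p2 -> p2 <= i -> cut p1 p2 i p4 p5 i = 3.
Proof. by rewrite /cut => ? ?; do ![case: ifP => //]; lia. Qed.

Lemma cut_matches c p1 p2 i p4 p5 : p1 <= p2 -> p2 <= i -> i < p4 -> p4 <= p5 -> i < n ->
  (forall j, j < n -> pattern_fits c (cut p1 p2 i p4 p5 j) (x j)) ->
  (exists2 j, j < n & pattern_fst c (cut p1 p2 i p4 p5 j) (x j)) ->
  (exists2 j, j < n & pattern_snd c (cut p1 p2 i p4 p5 j) (x j)) -> matches c.
Proof.
move=> h1 h2 h3 h4 i_n Hfit H1 H2; exists (cut p1 p2 i p4 p5); split=> //.
- by move=> j k jk _; apply: cut_homo.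
- by exists i => //; split=> [|j _]; [apply: cutE | apply: cut_eq3].
Qed.

Hypothesis start_N : lN (x 0).

Lemma last_N j : ~ last_is lR lN j -> last_is lN lR j.
Proof.
case/not_last_is=> // H; exists 0 => //; split=> // k /andP[_ kj]; exact: H.
Qed.

(** Let [a] be the task up to the trigger that made the requirement false for the last time, and [b]
    the task that set the deadline. Whether [b] comes before [i], and if so before [a], selects the
    pattern; the segments are cut at [a], [b] and [i]. *)
Lemma violation_matches_achievement : violation Achievement ->
  exists2 c, c < 3 & matches c.
Proof.
case=> i [k [/andP[ik kn] Ti [[b bk [Db HE]] HR]]].
have [|a ai [Na Ha]] := @last_N i; first by apply: HR; rewrite leqnn.
have nR j : a <= j <= k -> noR (x j).
  move=> /andP[aj jk]; rewrite /noR; case: (ltnP i j) => [ij|ji].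
    by apply/negP => Rj; apply: (HR j); [lia | apply: last_is_here].
  move: aj; rewrite leq_eqVlt => /predU1P[<-|aj]; last by apply: Ha; rewrite aj.
  by have := @exclRN a; rewrite Na andbT; apply; lia.
have nE j : b <= j <= k -> noE (x j).
  move=> /andP[]; rewrite leq_eqVlt => /predU1P[<- _|bj jk].
    by have := @exclDE b; rewrite Db /=; apply; lia.
  by apply: HE; rewrite bj.
have i_n : i < n by lia.
have an : a < n by lia.
have bn : b < n by lia.
case: (leqP i b) => ib; last case: (leqP a b) => ab.
- exists 0 => //; apply: (@cut_matches 0 a a i b.+1 b.+1) => //.
  + move=> j jn; rewrite /cut; do ![case: ifP => ?]; rewrite /pattern_fits //=; first
      [ by exfalso; lia
      | by apply: nR; lia
      | (have -> : j = i by lia); rewrite /with_T Ti nR //; lia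
      | by apply: nR; lia ].
  + by exists a => //; rewrite /cut; do ![case: ifP => //=]; lia.
  + by exists b => //; rewrite /cut; do ![case: ifP => //=]; lia.
- exists 1 => //; apply: (@cut_matches 1 a b i i.+1 i.+1) => //.
  + exact: ltnW.
  + move=> j jn; rewrite /cut; do ![case: ifP => ?]; rewrite /pattern_fits //=; first
      [ by exfalso; lia
      | (have -> : j = i by lia); rewrite /with_T /noRE Ti nR ?nE //; lia
      | by rewrite /noRE nR ?nE //; lia
      | by apply: nR; lia ].
  + by exists a => //; rewrite /cut; do ![case: ifP => //=]; lia.
  + by exists b => //; rewrite /cut; do ![case: ifP => //=]; lia.
- exists 2 => //; apply: (@cut_matches 2 b a i i.+1 i.+1) => //.
  + exact: ltnW.
  + move=> j jn; rewrite /cut; do ![case: ifP => ?]; rewrite /pattern_fits //=; first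
      [ by exfalso; lia
      | (have -> : j = i by lia); rewrite /with_T /noRE Ti nR ?nE //; lia
      | by rewrite /noRE nR ?nE //; lia
      | by apply: nE; lia ].
  + by exists a => //; rewrite /cut; do ![case: ifP => //=]; lia.
  + by exists b => //; rewrite /cut; do ![case: ifP => //=]; lia.
Qed.

Definition last_isb (P Q : letter -> bool) (j : nat) : bool :=
  [exists b : 'I_j.+1, P (x b) && [forall k : 'I_j.+1, (b < k) ==> ~~ Q (x k)]].

Lemma last_isP P Q j : reflect (last_is P Q j) (last_isb P Q j).
Proof.
apply: (iffP existsP) => [[b /andP[Pb /forallP H]]|[b bj [Pb H]]].
  exists b; first by rewrite -ltnS.
  split=> // k /andP[bk]; rewrite -ltnS => kj.
  by have := H (Ordinal kj); rewrite /= bk.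
exists (Ordinal (bj : b < j.+1)); rewrite Pb; apply/forallP => k; apply/implyP => bk.
by apply: H; rewrite bk -ltnS /=.
Qed.

(** Take the first position [k] from the trigger [i] on where the requirement fails. If [k] is [i],
    this is pattern 3. Otherwise the requirement held just before, so task [k] itself sets its
    complement and forms segment 5; the patterns 4 and 5 differ in why the deadline does not hold at
    [i]. *)
Lemma violation_matches_maintenance : violation Maintenance ->
  exists2 c, 3 <= c < 6 & matches c.
Proof.
case=> i [k0 [/andP[ik0 kn0] Ti [HR0 HD0]]].
have exk : exists k, (i <= k <= k0) && ~~ last_isb lR lN k.
  by exists k0; rewrite ik0 leqnn; apply/last_isP.
case: (ex_minnP exk) => k /andP[/andP[ik kk0] /last_isP HR] min_k {exk}.
have kn : k < n by lia.
have {HD0}HD j : i <= j < k -> ~ last_is lD lE j by move=> ij; apply: HD0; lia.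
have i_n : i < n by lia.
move: ik; rewrite leq_eqVlt => /predU1P[Eik|ik].
  subst k; have [a ai [Na Ha]] := last_N HR.
  have an : a < n by lia.
  have nR j : a <= j <= i -> noR (x j).
    move=> /andP[]; rewrite leq_eqVlt => /predU1P[<- _|aj ji].
      by have := @exclRN a; rewrite Na andbT; apply; lia.
    by apply: Ha; rewrite aj.
  exists 3 => //; apply: (@cut_matches 3 a a i i.+1 i.+1) => //.
  + move=> j jn; rewrite /cut; do ![case: ifP => ?]; rewrite /pattern_fits //=; first
      [ by exfalso; lia
      | (have -> : j = i by lia); rewrite /with_T Ti nR //; lia
      | by apply: nR; lia ].
  + by exists a => //; rewrite /cut; do ![case: ifP => //=]; lia.
  + by exists i => //; rewrite cutE.
have Nk : lN (x k).
  have : last_isb lR lN k.-1.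
    by apply: contraT => H; have := min_k k.-1; rewrite H andbT; lia.
  case/last_isP=> b bk [Rb Hb]; apply/negP => nN; apply: HR.
  exists b; first lia; split=> // l /andP[bl lk].
  by case: (ltngtP l k) => [lk'| |->]; [apply: Hb; lia | lia | apply/negP].
have nD j : i <= j < k -> noD (x j).
  by move=> ij; apply/negP => Dj; apply: (HD j ij); apply: last_is_here.
case: (@not_last_is lD lE i) => [|[b bi [Eb Hb]]|HD'].
- by apply: HD; rewrite leqnn.
- have bn : b < n by lia.
  have nD' j : b <= j < k -> noD (x j).
    move=> /andP[bj jk]; case: (leqP i j) => ij; first by apply: nD; rewrite ij.
    move: bj; rewrite leq_eqVlt => /predU1P[<-|bj]; last by apply: Hb; lia.
    by have := @exclDE b; rewrite Eb andbT; apply; lia.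
  exists 5 => //; apply: (@cut_matches 5 b b i k k.+1) => //.
  + move=> j jn; rewrite /cut; do ![case: ifP => ?]; rewrite /pattern_fits //=; first
      [ by exfalso; lia
      | by have -> : j = k by lia
      | by apply: nD'; lia
      | (have -> : j = i by lia); rewrite /with_T Ti nD' //; lia
      | by apply: nD'; lia ].
  + by exists b => //; rewrite /cut; do ![case: ifP => //=]; lia.
  + by exists k => //; rewrite /cut; do ![case: ifP => //=]; lia.
- exists 4 => //; apply: (@cut_matches 4 i i i k k.+1) => //.
  + move=> j jn; rewrite /cut; do ![case: ifP => ?]; rewrite /pattern_fits //=; first
      [ by exfalso; lia
      | by have -> : j = k by lia
      | by apply: nD; lia
      | (have -> : j = i by lia); rewrite /with_T Ti nD //; lia
      | by apply: HD'; lia ].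
  + by exists i => //; rewrite cutE.
  + by exists k => //; rewrite /cut; do ![case: ifP => //=]; lia.
Qed.

End Positions.

(** * From traces to letters *)

Definition read_letter (o : obligation) (L : seq literal) : letter :=
  (requirement o \in L, compl (requirement o) \in L, trigger o \in L,
   deadline o \in L, compl (deadline o) \in L).

Lemma complK : involutive compl.
Proof. by case=> b x; rewrite /compl /= negbK. Qed.

Lemma mem_oplus l L1 L2 :
  (l \in oplus L1 L2) = (l \in L1) && (compl l \notin L2) || (l \in L2).
Proof.
rewrite mem_cat mem_filter andbC; congr (_ && ~~ _ || _).
by rewrite -[in LHS](complK l) mem_map //; apply: inv_inj; apply: complK.
Qed.

Lemma consistent_excl L l : consistent L -> ~~ ((l \in L) && (compl l \in L)).
Proof. by move=> /allP H; apply/andP => -[/H/negP]. Qed.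

Section Compliance.
Variables (ann : annotation) (o : obligation) (e : seq task).
Let sigma := nth [::] (trace ann e).
Let lit i := ann (nth [::] e i).

Lemma mem_trace l j : j < size e -> l \in sigma j <->
  exists2 b, b <= j & l \in lit b /\ forall k, b < k <= j -> compl l \notin lit k.
Proof.
have step i : i < size e -> sigma i = oplus (if i is i'.+1 then sigma i' else [::]) (lit i).
  move=> lt_i; rewrite /sigma /trace nth_scanl ?size_map //.
  rewrite (take_nth [::]) ?size_map // -cats1 foldl_cat /= (nth_map [::]) //.
  case: i lt_i => [|i] lt_i; first by rewrite take0.
  by rewrite nth_scanl // size_map ltnW.
elim: j => [|j IH] lt_j; rewrite step // mem_oplus.
  split=> [|[[|//] _ [-> _]]]; last by rewrite orbT.
  by rewrite in_nil /= => H; exists 0 => //; split=> // k; lia.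
have {}IH := IH (ltnW lt_j); split.
  case/orP=> [/andP[/IH[b bj [Hb H]] HN]|H].
    exists b; first exact: leqW; split=> // k /andP[bk].
    rewrite leq_eqVlt => /predU1P[->//|kj]; by apply: H; rewrite bk.
  by exists j.+1 => //; split=> // k; lia.
case=> b; rewrite leq_eqVlt => /predU1P[->|bj] [Hb H]; first by rewrite Hb orbT.
apply/orP; left; rewrite H ?bj ?leqnn // andbT; apply/IH.
by exists b => //; split=> // k /andP[bk kj]; apply: H; rewrite bk leqW.
Qed.

Hypothesis cons : forall s, s \in e -> consistent (ann s).
Let x i := read_letter o (lit i).
Let n := size e.

Lemma trace_requirement j : j < n -> requirement o \in sigma j <-> last_is x lR lN j.
Proof. exact: mem_trace. Qed.

Lemma trace_deadline j : j < n -> deadline o \in sigma j <-> last_is x lD lE j.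
Proof. exact: mem_trace. Qed.

Hypotheses (e_gt0 : 0 < n) (first_N : lN (x 0)) (last_D : lD (x n.-1)).

(** Since the deadline holds in the last state, each trigger has a first position [k] from it on
    where the deadline holds, and the requirement between the trigger and [k] decides compliance for
    both types. *)
Lemma complies_violation :
  complies ann e o <-> ~ violation n x (type_of o).
Proof.
have Dn : deadline o \in sigma n.-1.
  by apply/trace_deadline; [rewrite prednK | apply: last_is_here].
have exk i : i < n -> exists k, (i <= k < n) && (deadline o \in sigma k).
  by move=> i_n; exists n.-1; rewrite Dn andbT; lia.
rewrite /complies /violation; split.
  move=> H [i [k [/andP[ik kn] Ti]]]; have i_n : i < n by lia.
  have := H i i_n Ti; case: (type_of o) => -[j [/andP[ij jn] H1 H2]] [H3 H4].
    apply: H2; exists k; split; last by apply/trace_deadline.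
    rewrite ik /= ltnNge; apply/negP => jk.
    by apply: (H4 j); [rewrite ij | apply/trace_requirement].
  case: (ltnP j k) => jk; last by apply/H3/trace_requirement => //; apply: H2; rewrite ik.
  by apply: (H4 j); [rewrite ij | apply/trace_deadline].
move=> H i i_n Ti; case: (ex_minnP (exk i i_n)) => k /andP[/andP[ik kn] Dk] min_k.
case: (type_of o) H => H.
  have [/existsP[j /andP[ij Rj]]|nR] :=
    boolP [exists j : 'I_k.+1, (i <= j) && (requirement o \in sigma j)].
    exists j; have jk : j <= k by rewrite -ltnS.
    split=> //; first by rewrite ij (leq_ltn_trans jk).
    case=> l [/andP[il lj] Dl]; have := min_k l; rewrite il Dl; lia.
  case: H; exists i, k; split=> //; first by rewrite ik.
  split; first by apply/trace_deadline.
  move=> j /andP[ij jk] /trace_requirement Rj; case/existsP: nR.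
  exists (Ordinal (jk : j < k.+1)); rewrite /= ij; apply: Rj; lia.
have [/forallP aR|/forallPn[l]] :=
  boolP [forall l : 'I_k.+1, (i <= l) ==> (requirement o \in sigma l)].
  exists k; split; rewrite ?ik // => l /andP[il lk].
  by have := aR (Ordinal (lk : l < k.+1)); rewrite /= il.
rewrite negb_imply => /andP[il nR]; have lk : l <= k by rewrite -ltnS.
case: H; exists i, l; split=> //; first by rewrite il (leq_ltn_trans lk).
split; first by move/trace_requirement => /(_ (leq_ltn_trans lk kn)) Rl; rewrite Rl in nR.
move=> j /andP[ij jl] /trace_deadline Dj; have := min_k j; rewrite ij Dj; lia.
Qed.

Lemma complies_matches :
  complies ann e o <->
  ~ exists2 c, (c < 6) && (achieving c == is_achievement (type_of o)) & matches n x c.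
Proof.
have exRN i : i < n -> ~~ (lR (x i) && lN (x i)).
  by move=> i_n; apply/consistent_excl/cons/mem_nth.
have exDE i : i < n -> ~~ (lD (x i) && lE (x i)).
  by move=> i_n; apply/consistent_excl/cons/mem_nth.
rewrite complies_violation; split=> H.
  case=> c /andP[c6 /eqP Ec] /(matches_violation exRN exDE c6); rewrite Ec => V.
  by apply: H; move: V; case: (type_of o).
move=> V; apply: H; case E: (type_of o) V => /= V.
  have [c c3 M] := violation_matches_achievement exRN exDE first_N V.
  by exists c => //; rewrite (leq_trans c3) /achieving ?c3.
have [c /andP[c3 c6] M] := violation_matches_maintenance exRN exDE first_N V.
by exists c => //; rewrite c6 /achieving ltnNge c3.
Qed.

End Compliance.

Definition pat_fits (c : 'I_6) (l : 'I_7) (x : letter) := pattern_fits c l x.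
Definition pat_gain (c : 'I_6) (l : 'I_7) (x : letter) : weight :=
  Some (l == 3 :> nat, pattern_fst c l x, pattern_snd c l x).

Definition complete : weight := Some (true, true, true).

(** Hence a complete weight means that exactly one task meets [p], while [f] and [g] are each met at
    least once. *)
Lemma big_wadd (T : Type) (p f g : pred T) (e : seq T) :
  \big[wadd/wone]_(s <- e) Some (p s, f s, g s) =
  if count p e <= 1 then Some (has p e, has f e, has g e) else None.
Proof.
elim: e => [|s e IH]; first by rewrite big_nil.
rewrite big_cons IH /= has_count; case: (p s); case: (count p e) => [|[|k]] //=.
Qed.

Lemma matches_labelled (rd : task -> letter) (e : seq task) (c : 'I_6) : uniq e ->
  matches (size e) (fun i => rd (nth [::] e i)) c <->
  exists lam, labelled pat_fits rd c lam ord0 ord_max e /\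
    gains pat_gain rd c lam e = complete.
Proof.
move=> U; split.
  case=> f [mono fit [i i_n [fi Ui]] [a a_n Fa] [b b_n Fb]].
  (* Beyond its seven classes [pattern_fits] takes the default [none], which fits no letter. *)
  have f7 j : j < size e -> f j < 7.
    move=> jn; have := fit j jn; rewrite /pattern_fits ltnNge; apply: contraTN => fj.
    by rewrite nth_default //; case: (nat_of_ord c) => [|[|[|[|[|?]]]]].
  pose lam s : 'I_7 := inord (f (index s e)).
  have lamE j : j < size e -> lam (nth [::] e j) = f j :> nat.
    by move=> jn; rewrite /lam index_uniq // inordK // f7.
  exists lam; split.
    apply/andP; split.
      rewrite sorted_pairwise; last by move=> ? ? ?; apply: leq_trans.
      apply/(pairwiseP [::]) => j k; rewrite !inE => jn kn jk /=.
      by rewrite !lamE // mono // ltnW.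
    apply/allP => s Hs; rewrite -(nth_index [::] Hs) /pat_fits lamE ?index_mem //.
    by rewrite fit ?index_mem // andbT /= -ltnS f7 // index_mem.
  rewrite /gains big_wadd.
  have -> : count (fun s => lam s == 3 :> nat) e = 1.
    rewrite (@eq_in_count _ _ (pred1 (nth [::] e i))) ?count_uniq_mem ?mem_nth // => s Hs /=.
    rewrite -(nth_index [::] Hs) lamE ?index_mem // nth_uniq ?index_mem //.
    by apply/eqP/eqP => [/Ui-> //|->//]; rewrite index_mem.
  rewrite /complete; congr (Some (_, _, _)); apply/hasP.
  - by exists (nth [::] e i); rewrite ?mem_nth // lamE // fi.
  - by exists (nth [::] e a); rewrite ?mem_nth // lamE.
  - by exists (nth [::] e b); rewrite ?mem_nth // lamE.
case=> lam [/andP[]]; rewrite sorted_pairwise; last by move=> ? ? ?; apply: leq_trans.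
move=> /(pairwiseP [::]) Hs /allP Ha; rewrite /gains big_wadd.
case: leqP => // Hc [] /hasP[s0 Hs0 E0] /hasP[s1 Hs1 E1] /hasP[s2 Hs2 E2].
exists (fun i => lam (nth [::] e i)); split.
- move=> i j; rewrite leq_eqVlt => /predU1P[->//|ij] jn.
  by apply: Hs => //; rewrite inE // (ltn_trans ij).
- by move=> i i_n; have /andP[_] := Ha _ (mem_nth [::] i_n).
- exists (index s0 e); rewrite ?index_mem // nth_index //; split; first exact/eqP.
  move=> j jn Ej; move: Hc; rewrite -size_filter => Hc.
  have M1 : s0 \in [seq s <- e | lam s == 3 :> nat] by rewrite mem_filter E0.
  have M2 : nth [::] e j \in [seq s <- e | lam s == 3 :> nat].
    by rewrite mem_filter Ej mem_nth.
  have -> : s0 = nth [::] e j.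
    by case: (filter _ _) Hc M1 M2 => [|t [|? ?]] // _; rewrite !inE => /eqP-> /eqP->.
  by rewrite index_uniq.
- by exists (index s1 e); rewrite ?index_mem // nth_index.
- by exists (index s2 e); rewrite ?index_mem // nth_index.
Qed.

(** * Parsing *)

Fixpoint branching (B : block) : bool :=
  if B is Node _ Bs then (1 < size Bs) && all branching Bs else true.

Lemma disjoint_tasksE Bs : pairwise disjoint_tasks Bs && all (fun B => uniq (tasks B)) Bs =
  uniq (flatten (map tasks Bs)).
Proof.
elim: Bs => //= B Bs IH; rewrite cat_uniq -IH.
have -> : all (disjoint_tasks B) Bs = ~~ has [in tasks B] (flatten (map tasks Bs)).
  elim: Bs {IH} => //= C Bs IH; rewrite has_cat negb_or IH.
  by congr (_ && _).
by case: (uniq _); case: (~~ has _ _); rewrite ?andbF ?andbT.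
Qed.

(** Separates the arity condition, which the parser checks at each node, from disjointness, which
    becomes one test on the list of all task names. *)
Lemma process_blockE B : process_block B = branching B && uniq (tasks B).
Proof.
elim/block_rect_nested: B => //= op Bs IH.
rewrite -disjoint_tasksE -andbA; congr (_ && _).
have -> : all process_block Bs = all branching Bs && all (fun B => uniq (tasks B)) Bs.
  elim: Bs IH => //= B Bs IHBs [-> /IHBs->].
  by case: (branching B); case: (all branching Bs); rewrite ?andbF ?andbT.
by case: (all branching Bs); case: (pairwise _ _); rewrite ?andbF ?andbT.
Qed.

Section Parser.
Variables (A : Type) (leaf : seq literal -> A) (node : operator -> seq A -> A).

(* Words are read from right to left, so that each [Close] announces a list of
   bits, of literals or of blocks, whose kind is only known from what follows. *)
Definition frame := (seq bool * seq literal * seq A)%type.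

Definition frame0 : frame := ([::], [::], [::]).

(* The obligations and the annotated tasks read so far, and the unfinished lists,
   innermost first. The stack is never empty, except after a syntax error. *)
Definition parser_state := (seq obligation * seq (name * seq literal) * seq frame)%type.

Definition state0 : parser_state := ([::], [::], [:: frame0]).

Definition literal0 : literal := (true, [::]).

Definition fail (st : parser_state) : parser_state := (st.1, [::]).

Definition push_frame (st : parser_state) : parser_state :=
  if nilp st.2 then st else (st.1, frame0 :: st.2).

Definition push_bit (b : bool) (st : parser_state) : parser_state :=
  let f := head frame0 st.2 in
  if ~~ nilp st.2 && (nilp f.1.2 && nilp f.2) then
    (st.1, (b :: f.1.1, [::], [::]) :: behead st.2) else fail st.

Definition push_literal (b : bool) (st : parser_state) : parser_state :=
  let f := head frame0 st.2 in let g := head frame0 (behead st.2) in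
  if ~~ nilp (behead st.2) && (nilp f.1.2 && (nilp f.2 && (nilp g.1.1 && nilp g.2))) then
    (st.1, ([::], (b, f.1.1) :: g.1.2, [::]) :: behead (behead st.2)) else fail st.

(** Three frames meet here: the name [f], the annotation [g] and the list of blocks [h] that
    receives the leaf. *)
Definition push_task (st : parser_state) : parser_state :=
  let f := head frame0 st.2 in let g := head frame0 (behead st.2) in
  let h := head frame0 (behead (behead st.2)) in
  if ~~ nilp (behead (behead st.2)) && (nilp f.1.2 && (nilp f.2 && (nilp g.1.1 &&
      (nilp g.2 && (nilp h.1.1 && nilp h.1.2))))) then
    ((st.1.1, (f.1.1, g.1.2) :: st.1.2),
     ([::], [::], leaf g.1.2 :: h.2) :: behead (behead (behead st.2)))
  else fail st.

Definition push_node (op : operator) (st : parser_state) : parser_state :=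
  let f := head frame0 st.2 in let g := head frame0 (behead st.2) in
  if ~~ nilp (behead st.2) && (nilp f.1.1 && (nilp f.1.2 &&
      (~~ nilp (behead f.2) && (nilp g.1.1 && nilp g.1.2)))) then
    (st.1, ([::], [::], node op f.2 :: g.2) :: behead (behead st.2)) else fail st.

Definition push_obligation (k : kind) (st : parser_state) : parser_state :=
  let f := head frame0 st.2 in let L := f.1.2 in
  if ~~ nilp st.2 && (nilp (behead st.2) && (nilp f.1.1 && (nilp f.2 &&
      (~~ nilp (behead (behead L)) && nilp (behead (behead (behead L))))))) then
    ((Obligation k (head literal0 L) (head literal0 (behead L))
        (head literal0 (behead (behead L))) :: st.1.1, st.1.2), [:: frame0])
  else fail st.

Definition parser_step (a : symbol) (st : parser_state) : parser_state :=
  match a with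
  | Bit b => push_bit b st
  | Sign b => push_literal b st
  | Leaf => push_task st
  | Open op => push_node op st
  | Oblig k => push_obligation k st
  | Close => push_frame st
  end.

Definition parse_word (w : seq symbol) : parser_state := foldr parser_step state0 w.

Variable ann : annotation.

Fixpoint eval (B : block) : A :=
  match B with
  | Task s => leaf (ann s)
  | Node op Bs => node op (map eval Bs)
  end.

Definition annotated (Bs : seq block) := [seq (s, ann s) | s <- flatten (map tasks Bs)].

Lemma parse_name x w obs ts stk : parse_word w = (obs, ts, stk) -> ~~ nilp stk ->
  parse_word (encode_name x ++ w) = (obs, ts, (x, [::], [::]) :: stk).
Proof.
move=> E nil; rewrite /encode_name cat_rcons.
by elim: x => [|b x IH] /=; [rewrite E /push_frame /= (negbTE nil) | rewrite IH].
Qed.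

Lemma parse_literals L w obs ts l stk : parse_word w = (obs, ts, ([::], l, [::]) :: stk) ->
  parse_word (flatten (map encode_literal L) ++ w) = (obs, ts, ([::], L ++ l, [::]) :: stk).
Proof.
move=> E; elim: L => //= [[b x] L IH]; rewrite -catA /=.
by rewrite (parse_name _ IH).
Qed.

Lemma parse_block B w obs ts v stk : branching B ->
  parse_word w = (obs, ts, ([::], [::], v) :: stk) ->
  parse_word (encode_block ann B ++ w) =
    (obs, annotated [:: B] ++ ts, ([::], [::], eval B :: v) :: stk).
Proof.
rewrite /annotated /= cats0.
elim/block_rect_nested: B w obs ts v stk => [s|op Bs IH] w obs ts v stk /=.
  move=> _ E; rewrite -catA cat_rcons.
  have E1 : parse_word (Close :: w) = (obs, ts, frame0 :: ([::], [::], v) :: stk).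
    by rewrite /= E.
  by rewrite (parse_name _ (parse_literals _ E1)) //= /push_task /= cats0.
case/andP=> size_Bs brBs E; rewrite cat_rcons.
have E1 : parse_word (Close :: w) = (obs, ts, frame0 :: ([::], [::], v) :: stk).
  by rewrite /= E.
suff -> : parse_word (flatten (map (encode_block ann) Bs) ++ Close :: w) =
    (obs, [seq (s, ann s) | s <- flatten (map tasks Bs)] ++ ts,
     ([::], [::], map eval Bs) :: ([::], [::], v) :: stk).
  by rewrite /push_node /=; case: (Bs) size_Bs => [|? []].
elim: Bs IH brBs {size_Bs} => [|B Bs IHBs] /= => [_ _|[IHB IH] /andP[brB brBs]].
  by rewrite E /push_frame.
by rewrite -catA (IHB _ _ _ _ _ brB (IHBs IH brBs)) map_cat catA.
Qed.

Lemma parse_obligations obs :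
  parse_word (flatten (map encode_obligation obs)) = (obs, [::], [:: frame0]).
Proof.
elim: obs => [//|[k r t d] obs IH].
have -> : flatten (map encode_obligation (Obligation k r t d :: obs)) =
    Oblig k :: flatten (map encode_literal [:: r; t; d]) ++
      flatten (map encode_obligation obs).
  by rewrite /= cats0 -!catA.
have := parse_literals [:: r; t; d] IH; move: (flatten (map encode_literal _) ++ _) => u E.
by rewrite [LHS]/= E.
Qed.

Lemma parse_encoding B obs : branching B ->
  parse_word (encode_block ann B ++ flatten (map encode_obligation obs)) =
    (obs, annotated [:: B], [:: ([::], [::], [:: eval B])]).
Proof. by move=> brB; rewrite (parse_block brB (parse_obligations obs)) cats0. Qed.

(** * Soundness of the parser *)

Definition print_frame (f : seq bool * seq literal * seq block) : seq symbol :=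
  map Bit f.1.1 ++ flatten (map encode_literal f.1.2) ++ flatten (map (encode_block ann) f.2).

Definition eval_frame (f : seq bool * seq literal * seq block) : frame := (f.1, map eval f.2).

(** The parser has forgotten the blocks. The invariant supplies blocks that evaluate to the stored
    attributes and whose frames, separated by [Close], print as the word read so far. *)
Definition printed (w : seq symbol) (st : parser_state) : Prop :=
  exists f stk,
  [/\ st.2 = map eval_frame (f :: stk),
      w = print_frame f ++ flatten [seq Close :: print_frame g | g <- stk] ++
          flatten (map encode_obligation st.1.1),
      all (fun g => all branching g.2) (f :: stk)
    & map fst st.1.2 = flatten [seq flatten (map tasks g.2) | g <- f :: stk]].

(** An empty stack is never left, and recorded tasks are never removed, so both hypotheses pass to
    every suffix of the word. The second lets [ann] be chosen after the whole parse. *)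
Lemma parse_printed w : (parse_word w).2 <> [::] ->
  (forall x L, (x, L) \in (parse_word w).1.2 -> ann x = L) -> printed w (parse_word w).
Proof.
elim: w => [|a w IH] /=; first by move=> _ _; exists ([::], [::], [::]), [::].
case: (parse_word w) IH => [[obs ts] stk] /= IH Hne Hann.
have {}IH : printed w (obs, ts, stk).
  apply: IH; first by move=> E; apply: Hne; rewrite E; case: a {Hann}.
  move=> x L Hx; apply: Hann; move: Hx.
  by case: a {Hne} => [b|b||op|k|] /=; rewrite /push_frame /push_bit /push_literal
    /push_task /push_node /push_obligation /fail; case: ifP => //= _; rewrite inE orbC => ->.
case: IH => [[[b0 l0] v0]] [fs] /= [Estk Ew Hbr Ets].
rewrite /printed Ew {Ew}; case: a Hne Hann => [b|b||op|k|]; rewrite Estk /=.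
- rewrite /push_bit /=; case: l0 v0 Estk Hbr Ets => [|? ?] [|? ?] //= Estk Hbr Ets _ _.
  by exists (b :: b0, [::], [::]), fs.
- rewrite /push_literal /=; case: l0 v0 Estk Hbr Ets => [|? ?] [|? ?] //=;
    case: fs => [|[[[|? ?] l1] [|? ?]] fs] //= Estk Hbr Ets _ _.
  exists ([::], (b, b0) :: l1, [::]), fs; split=> //.
  by rewrite /print_frame /= !cats0 /encode_literal /encode_name cat_rcons -!catA.
- rewrite /push_task /=; case: l0 v0 Estk Hbr Ets => [|? ?] [|? ?] //=;
    case: fs => [|[[[|? ?] l1] [|? ?]] [|[[[|? ?] [|? ?]] v2] fs]] //= Estk Hbr Ets _ Hann.
  have E : ann b0 = l1 by apply: Hann; rewrite inE eqxx.
  exists ([::], [::], Task b0 :: v2), fs; split=> //=.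
  + by rewrite /eval_frame /= E.
  + by rewrite E /print_frame /= !cats0 /encode_name -!catA /= !cat_rcons -!catA /=.
  + exact: (congr1 (cons b0) Ets).
- rewrite /push_node /=; case: b0 l0 Estk Hbr Ets => [|? ?] [|? ?] //=;
    case: v0 => [|B0 [|B1 v0]] //=;
    case: fs => [|[[[|? ?] [|? ?]] v1] fs] //= Estk Hbr Ets _ _.
  exists ([::], [::], Node op [:: B0, B1 & v0] :: v1), fs; split=> //=.
  + by rewrite /print_frame /= !cat_rcons -?catA /= -?catA.
  + by move: Hbr; rewrite -!andbA.
  + by move: Ets; rewrite -?catA.
- rewrite /push_obligation /=; case: fs Estk Hbr Ets => [|? ?] //=;
    case: b0 v0 => [|? ?] [|? ?] //=;
    case: l0 => [|r [|t [|d [|? ?]]]] //= Estk Hbr Ets _ _.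
  exists ([::], [::], [::]), [::]; split=> //=.
  by rewrite /print_frame /encode_literal /= ?cats0 -?catA /= -?catA /= ?cats0 -?catA.
- rewrite /push_frame /= => _ _.
  exists ([::], [::], [::]), ((b0, l0, v0) :: fs); split=> //=.
  by rewrite -catA.
Qed.

Lemma parse_sound w obs ts v : parse_word w = (obs, ts, [:: ([::], [::], [:: v])]) ->
  (forall x L, (x, L) \in ts -> ann x = L) ->
  exists B, [/\ w = encode_block ann B ++ flatten (map encode_obligation obs),
    branching B, map fst ts = tasks B & v = eval B].
Proof.
move=> E Hann; have := @parse_printed w; rewrite E => H.
have {H}[|[[b l] vs] [stk [/= Estk -> Hbr Ets]]] := H _ Hann; first by [].
case: Estk Hbr Ets => <- <-; case: stk => //.
case: vs => [|B [|? ?]] //= [->] _ /andP[/andP[brB _] _]; rewrite !cats0 => Ets.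
by exists B; split=> //; rewrite /print_frame /= cats0.
Qed.

End Parser.

(** * The decision procedure *)

Lemma executions_uniq B e : uniq (tasks B) -> e \in executions B -> uniq e.
Proof.
elim/block_rect_nested: B e => [s|op Bs IH] e /=; first by move=> _; rewrite inE => /eqP->.
have IHs es : uniq (flatten (map tasks Bs)) -> es \in choices (map executions Bs) ->
    uniq (flatten es).
  elim: Bs IH es => [_|B Bs IHBs [IHB /IHBs{}IH]] es; first by rewrite inE => _ /eqP->.
  move=> /=/[dup]U; rewrite cat_uniq => /and3P[U1 _ U2].
  case/mem_choicesP=> f [g [Hf Hg ->]] /=.
  rewrite cat_uniq (IHB _ U1 Hf) (IH _ U2 Hg) andbT; apply/hasPn => s /= Hs.
  apply: contraL (mem_choices_executions Hg Hs) => /(mem_executions Hf).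
  exact: disjoint_flatten.
move=> U; case: op.
- by case/mapP=> es Hes ->; apply: IHs.
- elim: Bs IH U {IHs} => //= B Bs IHBs [IHB /IHBs{}IH].
  by rewrite cat_uniq mem_cat => /and3P[U1 _ U2] /orP[/(IHB _ U1)|/(IH U2)].
- case/flattenP=> _ /mapP[es Hes ->]; rewrite mem_filter mem_permutations => /andP[_ P].
  by rewrite (perm_uniq P) IHs.
Qed.

Definition pattern_value := value 'I_6 7.

Definition accepts (o : obligation) (v : pattern_value) : bool :=
  all (fun c : 'I_6 => (achieving c == is_achievement (type_of o)) ==>
                       ((c, ord0, ord_max, complete) \notin v)) (enum 'I_6).

Section Compliant.
Variables (P : model) (ann : annotation) (o : obligation).
Let rd s := read_letter o (ann s).

Hypothesis block_P : process_block (model_block P).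
Hypothesis cons : forall s, s \in tasks (model_block P) -> consistent (ann s).
Hypothesis start_r : compl (requirement o) \in ann (start P).
Hypothesis finish_d : deadline o \in ann (finish P).

Lemma mem_model_executions e : e \in executions (model_block P) ->
  exists e', e = start P :: rcons e' (finish P).
Proof.
case/mapP=> es /mem_choicesP[e1 [f1 [H1 H E1]]] ->.
case/mem_choicesP: H => e2 [f2 [_ H E2]]; case/mem_choicesP: H => e3 [f3 [H3 H4 E3]].
move: H1 H3 H4; rewrite E1 E2 E3 !inE => /eqP-> /eqP-> /eqP->.
by exists e2; rewrite /= -cats1.
Qed.

Lemma complies_accepts :
  (forall e, e \in executions (model_block P) -> complies ann e o) <->
  accepts o (block_value pat_fits pat_gain rd (model_block P)).
Proof.
have U : uniq (tasks (model_block P)) by move: block_P; rewrite process_blockE => /andP[].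
have M e : e \in executions (model_block P) -> complies ann e o <->
  ~ exists2 c, (c < 6) && (achieving c == is_achievement (type_of o)) &
      matches (size e) (fun i => read_letter o (ann (nth [::] e i))) c.
  move=> He; have [e' Ee] := mem_model_executions He.
  apply: complies_matches.
  - by move=> s Hs; apply: cons; apply: mem_executions He _ Hs.
  - by rewrite Ee.
  - by rewrite Ee.
  - by rewrite Ee /= size_rcons /= nth_rcons ltnn eqxx.
split=> [H|/allP H e He].
  apply/allP => c _; apply/implyP => Hc; apply/negP.
  case/(block_value_correct _ _ _ _ U) => -[e [lam [He Hl /esym Hg]]] _.
  have [/(_ (H e He)) nM _] := M e He; apply: nM; exists c; first by rewrite ltn_ord.
  by apply/(matches_labelled rd); [apply: executions_uniq He | exists lam].
apply/(M e He); case=> c /andP[c6 Hc] /(@matches_labelled rd e (Ordinal c6)).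
case; first exact: executions_uniq He.
move=> lam [Hl Hg]; have := H (Ordinal c6) (mem_enum _ _); rewrite /= Hc /= => /negP; apply.
by apply/(block_value_correct _ _ _ _ U); split=> //; exists e, lam; split.
Qed.

End Compliant.

(* Besides the value of a block, we record whether it is a task and whether it
   has the shape of [model_block]. *)
Definition attribute := (bool * bool * pattern_value)%type.

Definition attribute0 : attribute := (false, false, set0).

Definition leaf_attribute (o : obligation) (L : seq literal) : attribute :=
  (true, false, leaf_value pat_fits pat_gain (read_letter o L)).

Definition model_shape (op : operator) (vs : seq attribute) : bool :=
  if op is SEQ then
    ~~ nilp (behead (behead vs)) && (nilp (behead (behead (behead vs))) &&
    ((head attribute0 vs).1.1 && (head attribute0 (behead (behead vs))).1.1))
  else false.

Definition node_attribute (op : operator) (vs : seq attribute) : attribute :=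
  (false, model_shape op vs,
   foldr (fun v acc => comb_value op v.2 acc) (unit_value _ _ op) vs).

Definition parse_for (o : obligation) := parse_word (leaf_attribute o) node_attribute.

Definition attribute_of o (ann : annotation) := eval (leaf_attribute o) node_attribute ann.

Lemma attribute_value o ann B : (attribute_of o ann B).2 =
  block_value pat_fits pat_gain (fun s => read_letter o (ann s)) B.
Proof.
elim/block_rect_nested: B => //= op Bs IH.
by elim: Bs IH => //= B Bs IHBs [<- /IHBs->].
Qed.

Lemma attribute_task o ann B : (attribute_of o ann B).1.1 -> exists s, B = Task s.
Proof. by case: B => // s _; exists s. Qed.

Lemma attribute_model o ann B : (attribute_of o ann B).1.2 ->
  exists P, B = model_block P.
Proof.
case: B => //= op Bs; rewrite /model_shape; case: op => //.
case: Bs => [|B1 [|B2 [|B3 [|? ?]]]] //= /andP[/attribute_task[s ->] /attribute_task[t ->]].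
by exists (Model s B2 t).
Qed.

Lemma model_attribute o ann P : (attribute_of o ann (model_block P)).1.2.
Proof. by []. Qed.

Definition obligation0 := Obligation Achievement literal0 literal0 literal0.

Definition final (st : parser_state attribute) : bool :=
  let f := head (@frame0 attribute) st.2 in
  ~~ nilp st.2 && (nilp (behead st.2) && (nilp f.1.1 && (nilp f.1.2 &&
    (~~ nilp f.2 && nilp (behead f.2))))).

Definition root_attribute (st : parser_state attribute) : attribute :=
  head attribute0 (head (@frame0 attribute) st.2).2.

Definition annotation0 : name * seq literal := ([::], [::]).

(** Reading from the right and recording in front keeps the tasks in the order of the word, so the
    first is the start task and the last the end task. The word is parsed anew for each [o], on
    which the leaf values depend. *)
Definition obligation_ok (w : seq symbol) (ts : seq (name * seq literal)) (o : obligation) :=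
  (compl (requirement o) \in (head annotation0 ts).2) &&
  ((deadline o \in (head annotation0 (rev ts)).2) &&
    accepts o (root_attribute (parse_for o w)).2).

(** The parse for the dummy [obligation0] checks the syntax and extracts the tasks and the
    obligations. *)
Definition decide (w : seq symbol) : bool :=
  let st := parse_for obligation0 w in
  final st && ((root_attribute st).1.2 && (uniq (map fst st.1.2) &&
    (all (fun t => consistent t.2) st.1.2 && all (obligation_ok w st.1.2) st.1.1))).

Lemma finalP st : final st -> st = (st.1.1, st.1.2, [:: ([::], [::], [:: root_attribute st])]).
Proof. by case: st => [[obs ts] [|[[[|? ?] [|? ?]] [|? [|? ?]]] [|? ?]]]. Qed.

Lemma root_attribute1 obs ts v : root_attribute (obs, ts, [:: ([::], [::], [:: v])]) = v.
Proof. by []. Qed.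

Lemma annotated_model ann P : annotated ann [:: model_block P] =
  (start P, ann (start P)) :: rcons (annotated ann [:: body P]) (finish P, ann (finish P)).
Proof. by rewrite /annotated /= !cats0 map_cat cats1. Qed.

Lemma obligation_okE P ann obs o :
  branching (model_block P) ->
  obligation_ok (encode (Instance P ann obs)) (annotated ann [:: model_block P]) o =
  [&& compl (requirement o) \in ann (start P), deadline o \in ann (finish P)
    & accepts o (block_value pat_fits pat_gain (fun s => read_letter o (ann s))
                   (model_block P))].
Proof.
move=> br; rewrite /obligation_ok /parse_for (parse_encoding _ _ _ _ br).
rewrite root_attribute1 -/(attribute_of o ann _) attribute_value annotated_model.
by rewrite rev_cons rev_rcons.
Qed.

Theorem decide_language w : decide w <-> language encode admissible fully_compliant w.
Proof.
split.
  case/andP=> /finalP; set st := parse_for _ w => Est /andP[Hm /andP[U /andP[/allP C /allP O]]].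
  (* The annotation is looked up among the recorded tasks; as their names are distinct, it agrees
     with every record. *)
  pose ann s := head [::] [seq p.2 | p <- st.1.2 & p.1 == s].
  have Hann x L : (x, L) \in st.1.2 -> ann x = L.
    rewrite /ann; elim: (st.1.2) U => //= -[y M] ts IH /= /andP[Hy U].
    rewrite inE => /predU1P[[-> ->]|Hx]; first by rewrite eqxx.
    case: eqP => [Ey|_]; last exact: IH.
    by case/negP: Hy; rewrite Ey; apply: (map_f fst Hx).
  have [B [Ew br Ets Er]] := parse_sound Est Hann.
  have [P EB] : exists P, B = model_block P.
    by apply: (@attribute_model obligation0 ann); rewrite /attribute_of -Er.
  subst B; pose I := Instance P ann st.1.1; have {}Ew : w = encode I by [].
  have Ets' : st.1.2 = annotated ann [:: model_block P].
    rewrite {1}/st Ew /parse_for (parse_encoding _ _ _ _ br) //.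
  have adm : [/\ process_block (model_block P),
      (forall s, s \in tasks (model_block P) -> consistent (ann s))
    & forall o, o \in st.1.1 ->
        compl (requirement o) \in ann (start P) /\ deadline o \in ann (finish P)].
    split.
    - by rewrite process_blockE br -Ets.
    - move=> s; rewrite -Ets => /mapP[[t L] HtL /= ->].
      by rewrite (Hann _ _ HtL); apply: (C (t, L)).
    - by move=> o /O; rewrite Ets' Ew obligation_okE // => /and3P[].
  exists I; split=> // e He o Ho; case: adm => A1 A2 A3; have [A4 A5] := A3 o Ho.
  apply: (complies_accepts A1 A2 A4 A5).2 => //.
  by move: (O o Ho); rewrite Ets' Ew obligation_okE // => /and3P[].
case=> -[P ann obs] [-> [/= bP cP rP] FC].
have /andP[br U] : branching (model_block P) && uniq (tasks (model_block P)).
  by rewrite -process_blockE.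
rewrite /decide /parse_for (parse_encoding _ _ _ _ br) model_attribute.
apply/and5P; split=> //.
- by rewrite /annotated -map_comp map_id_in //= !cats0.
- apply/allP => -[s L] /mapP[t Ht [-> ->]] /=; apply: cP.
  by move: Ht; rewrite /= !cats0.
- apply/allP => o Ho; rewrite obligation_okE //; have [rS dF] := rP o Ho.
  rewrite rS dF; apply/(complies_accepts bP cP rS dF) => e He; exact: FC.
Qed.

(** * Polynomial running time of the decision procedure *)

HB.instance Definition _ (T : finType) :=
  isCoded.Build {set T} (inj_comp unary_inj (inj_comp val_inj (@enum_rank_inj {set T}))).

Definition obligation_tuple (o : obligation) :=
  (is_achievement (type_of o), (requirement o, (trigger o, deadline o))).

Lemma obligation_tuple_inj : injective obligation_tuple.
Proof. by move=> [[] r t d] [[] r' t' d'] // [-> -> ->]. Qed.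

HB.instance Definition _ := isCoded.Build obligation (inj_comp code_inj obligation_tuple_inj).

(** Second-order patterns extract the component functions; goals of any other form are left open. *)
Ltac polytime_tac := cbv beta; first [assumption | exact: polytime_id | exact: polytime_const
  | exact: polytime_proj1 | exact: polytime_proj2
  | lazymatch goal with
  | |- @polytime _ _ (fun x => (@?f x).1) => apply: (@polytime_fst _ _ _ f); polytime_tac
  | |- @polytime _ _ (fun x => (@?f x).2) => apply: (@polytime_snd _ _ _ f); polytime_tac
  | |- @polytime _ _ (fun x => (@?f x, @?g x)) =>
      apply: (@polytime_pair _ _ _ f g); polytime_tac
  | |- @polytime _ _ (fun x => @?f x && @?g x) => apply: (@polytime_and _ f g); polytime_tac
  | |- @polytime _ _ (fun x => ~~ @?f x) => apply: (@polytime_negb _ f); polytime_tac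
  | |- @polytime _ _ (fun x => if _ then _ else _) => apply: polytime_if; polytime_tac
  | |- @polytime _ _ (fun x => nilp (@?f x)) => apply: (@polytime_isnil _ _ f); polytime_tac
  | |- @polytime _ _ (fun x => behead (@?f x)) => apply: (@polytime_behead _ _ f); polytime_tac
  | |- @polytime _ _ (fun x => head ?y (@?f x)) => apply: (@polytime_head _ _ y f); polytime_tac
  | |- @polytime _ _ (fun x => rev (@?f x)) => apply: (@polytime_rev _ _ f); polytime_tac
  | |- @polytime _ _ (fun x => @?f x :: @?g x) => apply: (@polytime_cons _ _ f g); polytime_tac
  | |- _ => idtac
  end].

Lemma polytime_mem (X Y : codedType) (eqY : Y -> Y -> bool) (f : X -> Y) (l : X -> seq Y) :
  (forall x y, reflect (x = y) (eqY x y)) -> polytime f -> polytime l ->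
  polytime (fun x => has (eqY (f x)) (l x)).
Proof.
move=> H Hf Hl; apply: (@polytime_has _ _ (fun u => eqY (f u.1) u.2)) => //.
apply: (@polytime_eq _ _ eqY (fun u => f u.1) (fun u => u.2)) => //; polytime_tac.
exact: (polytime_comp Hf (@polytime_proj1 _ _)).
Qed.

Lemma polytime_mem_literal (X : codedType) (f : X -> literal) (l : X -> seq literal) :
  polytime f -> polytime l -> polytime (fun x => f x \in l x).
Proof.
move=> Hf Hl; have := @polytime_mem X _ (fun x y : literal => x == y) f l (fun x y => eqP) Hf Hl.
by apply: polytime_ext => x; rewrite -has_pred1; apply: eq_has => y; rewrite eq_sym.
Qed.

Lemma polytime_compl (X : codedType) (f : X -> literal) :
  polytime f -> polytime (fun x => compl (f x)).
Proof. by rewrite /compl => Hf; polytime_tac. Qed.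

Lemma polytime_consistent (X : codedType) (l : X -> seq literal) :
  polytime l -> polytime (fun x => consistent (l x)).
Proof.
move=> Hl; apply: (@polytime_all _ _ (fun u => compl u.2 \notin l u.1)) => //.
polytime_tac; apply: polytime_mem_literal; first by apply: polytime_compl; polytime_tac.
exact: (polytime_comp Hl (@polytime_proj1 _ _)).
Qed.

Lemma size_pair (X Y : codedType) (a : X) (b : Y) :
  tree_size (code (a, b)) = (tree_size (code a) + tree_size (code b)).+1.
Proof. exact: tree_sizeE. Qed.

Lemma size_cons (X : codedType) (a : X) (s : seq X) :
  tree_size (code (a :: s)) = (tree_size (code a) + tree_size (code s)).+1.
Proof. exact: tree_sizeE. Qed.

Lemma size_bool (b : bool) : tree_size (code b) <= 3.
Proof. by case: b. Qed.

(** The fold also carries the names already read, in which the next one is searched. *)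
Lemma polytime_uniq (X : codedType) (l : X -> seq name) :
  polytime l -> polytime (fun x => uniq (l x)).
Proof.
move=> Hl; pose g (u : X * (name * (bool * seq name))) :=
  (u.2.2.1 && (u.2.1 \notin u.2.2.2), u.2.1 :: u.2.2.2).
have Hg : polytime g.
  rewrite /g; polytime_tac; have H := @polytime_mem _ _ (fun x y : name => x == y)
    (fun u : X * (name * (bool * seq name)) => u.2.1) (fun u => u.2.2.2) (fun x y => eqP).
  apply: polytime_ext (H _ _) => [u||]; try by polytime_tac.
  by rewrite -has_pred1; apply: eq_has => y; rewrite eq_sym.
have H := polytime_foldr (r := fun n => n + 5) Hg _ _ (polytime_const _ (true, [::])) Hl.
apply: polytime_ext (polytime_fst (H _ _)) => [x||x y [b s]].
- have -> : foldr (fun y z => g (x, (y, z))) (true, [::]) (l x) = (uniq (l x), l x).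
    by elim: (l x) => //= y s ->; rewrite /g /= andbC.
  by [].
- by pol.
- have -> : g (x, (y, (b, s))) = (b && (y \notin s), y :: s) by [].
  rewrite !size_pair size_cons; have := size_bool (b && (y \notin s)).
  have := tree_size_gt0 (code b); lia.
Qed.

Lemma fin_bound (F : finType) (f : F -> nat) : exists C, forall x, f x <= C.
Proof. by exists (\max_x f x) => x; apply: leq_bigmax. Qed.

Lemma covers (T : codedType) (e : seq T) (a : T) : List.In a e -> has (same_code a) e.
Proof.
elim: e => //= b e IH [->|/IH->]; last by rewrite orbT.
by rewrite /same_code eqxx.
Qed.

Lemma In_mem (T : eqType) (a : T) (e : seq T) : a \in e -> List.In a e.
Proof. by elim: e => //= b e IH; rewrite inE => /predU1P[->|/IH]; [left | right]. Qed.

Lemma covers_symbol (a : symbol) : has (same_code a) symbols.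
Proof. by apply/covers/In_mem; case: a => [[]|[]||[]|[]|]. Qed.

Lemma polytime_of_letter (Y : codedType) (h : letter -> Y) : polytime h.
Proof.
apply: (@polytime_table _ _ (false, false, false, false, false) (enum {: letter})) => a.
by apply/covers/In_mem; rewrite mem_enum.
Qed.

(** There are 6 * 7 * 7 * 9 = 2646 keys and thus 2 ^ 2646 values, coded by rank in unary: huge, but
    independent of the input. *)
Lemma polytime_of_value (Y : codedType) (h : pattern_value -> Y) : polytime h.
Proof.
apply: (@polytime_table _ _ (set0 : pattern_value) (enum {: pattern_value})) => a.
by apply/covers/In_mem; rewrite mem_enum.
Qed.

Lemma polytime_of_values (Y : codedType) (h : pattern_value * pattern_value -> Y) :
  polytime h.
Proof.
apply: (@polytime_table _ _ (set0 : pattern_value, set0 : pattern_value)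
  (enum {: pattern_value * pattern_value})) => a.
by apply/covers/In_mem; rewrite mem_enum.
Qed.

Section Obligations.
Variables (X : codedType) (f : X -> obligation).
Hypothesis Hf : polytime f.

Let Ht : polytime (fun x => obligation_tuple (f x)).
Proof. exact: polytime_recode Hf. Qed.

Lemma polytime_is_achievement : polytime (fun x => is_achievement (type_of (f x))).
Proof. exact: polytime_fst Ht. Qed.

Lemma polytime_requirement : polytime (fun x => requirement (f x)).
Proof. exact: polytime_fst (polytime_snd Ht). Qed.

Lemma polytime_trigger : polytime (fun x => trigger (f x)).
Proof. exact: polytime_fst (polytime_snd (polytime_snd Ht)). Qed.

Lemma polytime_deadline : polytime (fun x => deadline (f x)).
Proof. exact: polytime_snd (polytime_snd (polytime_snd Ht)). Qed.

Lemma polytime_obligation (k : kind) (r t d : X -> literal) :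
  polytime r -> polytime t -> polytime d ->
  polytime (fun x => Obligation k (r x) (t x) (d x)).
Proof.
move=> Hr H't Hd.
apply: (@polytime_recode _ _ _ (fun x => (is_achievement k, (r x, (t x, d x))))) => //.
by polytime_tac.
Qed.

Lemma polytime_read_letter (l : X -> seq literal) : polytime l ->
  polytime (fun x => read_letter (f x) (l x)).
Proof.
move=> Hl; rewrite /read_letter.
do ![apply: polytime_pair]; apply: polytime_mem_literal => //;
  by [exact: polytime_requirement | exact: polytime_trigger | exact: polytime_deadline
     | exact: polytime_compl polytime_requirement | exact: polytime_compl polytime_deadline].
Qed.

Lemma polytime_leaf (l : X -> seq literal) : polytime l ->
  polytime (fun x => leaf_attribute (f x) (l x)).
Proof.
move=> Hl; apply: polytime_pair; first exact: polytime_const.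
apply: (@polytime_comp _ _ _ (leaf_value pat_fits pat_gain)).
  exact: polytime_of_letter.
exact: polytime_read_letter.
Qed.

Lemma polytime_accepts (v : X -> pattern_value) : polytime v ->
  polytime (fun x => accepts (f x) (v x)).
Proof.
(* [accepts] sees only the type of the obligation, so one table per type is enough. *)
move=> Hv; pose acc b (v : pattern_value) := accepts (Obligation
  (if b then Achievement else Maintenance) literal0 literal0 literal0) v.
have H b : polytime (fun x => acc b (v x)).
  exact: polytime_comp (polytime_of_value _) Hv.
apply: polytime_ext (polytime_if polytime_is_achievement (H true) (H false)) => x.
by case: (f x) => [[] r t d].
Qed.

End Obligations.

Lemma polytime_node_attribute (X : codedType) (op : operator) (l : X -> seq attribute) :
  polytime l -> polytime (fun x => node_attribute op (l x)).
Proof.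
move=> Hl; rewrite /node_attribute; apply: polytime_pair.
  apply: polytime_pair; first exact: polytime_const.
  by rewrite /model_shape; case: op; polytime_tac.
have [C HC] := fin_bound (fun v : pattern_value => tree_size (code v)).
pose g (u : X * (attribute * pattern_value)) : pattern_value := comb_value op u.2.1.2 u.2.2.
have Hg : polytime g.
  apply: (@polytime_comp _ _ _ (fun u => comb_value op u.1 u.2)
     (fun u : X * (attribute * pattern_value) => (u.2.1.2, u.2.2))).
    exact: polytime_of_values.
  by polytime_tac.
apply: (polytime_foldr (r := fun=> C) Hg) => //; first by pol.
  by move=> *; apply: leq_trans (HC _) (leq_addl _ _).
exact: polytime_const.
Qed.

Section ParserTime.
Variable X : codedType.
Variables (o : X -> obligation) (st : X -> parser_state attribute).
Hypotheses (Ho : polytime o) (Hst : polytime st).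

Lemma polytime_parser_step a :
  polytime (fun x => parser_step (leaf_attribute (o x)) node_attribute a (st x)).
Proof.
case: a => [b|b||op|k|]; rewrite /parser_step /push_bit /push_literal /push_task /push_node
  /push_obligation /push_frame /fail; polytime_tac.
- by apply: polytime_leaf => //; polytime_tac.
- by apply: polytime_node_attribute; polytime_tac.
- by apply: polytime_obligation; polytime_tac.
Qed.

End ParserTime.

Lemma size_frame (b : seq bool) (l : seq literal) (v : seq attribute) :
  tree_size (code ((b, l, v) : frame attribute)) =
  (tree_size (code b) + tree_size (code l) + tree_size (code v)).+2.
Proof. by rewrite !size_pair; lia. Qed.

Lemma size_state obs ts (stk : seq (frame attribute)) :
  tree_size (code ((obs, ts, stk) : parser_state attribute)) =
  (tree_size (code obs) + tree_size (code ts) + tree_size (code stk)).+2.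
Proof. by rewrite !size_pair; lia. Qed.

Lemma size_obligation (k : kind) (r t d : literal) : tree_size (code (Obligation k r t d)) <=
  tree_size (code r) + tree_size (code t) + tree_size (code d) + 6.
Proof.
rewrite [code _]/(code (is_achievement k, (r, (t, d)))) !size_pair.
have := size_bool (is_achievement k); lia.
Qed.

Lemma size_nil (Y : codedType) : tree_size (code ([::] : seq Y)) = 1.
Proof. by []. Qed.

(** This is the additive growth that [polytime_foldr] asks for: a step moves data between frames
    without duplicating it, and a new attribute has bounded size. *)
Lemma size_parser_step : exists C, forall o a (st : parser_state attribute),
  tree_size (code (parser_step (leaf_attribute o) node_attribute a st)) <=
  tree_size (code st) + C.
Proof.
have [C HC] := fin_bound (fun v : attribute => tree_size (code v)).
exists (C + 30) => o a [[obs ts] stk].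
have fail_le st : tree_size (code (fail st : parser_state attribute)) <=
    tree_size (code st) + (C + 30).
  by case: st => [[? ?] ?]; rewrite /fail !size_state size_nil /=; lia.
case: a => [b|b||op|k|]; rewrite /parser_step.
- rewrite /push_bit; case: ifP => // _; case: stk => [|[[b0 l0] v0] stk] //=;
    rewrite !(size_state, size_cons, size_frame, size_nil); have := size_bool b; lia.
- rewrite /push_literal; case: ifP => // _;
    case: stk => [|[[b0 l0] v0] [|[[b1 l1] v1] stk]] //=;
    rewrite !(size_state, size_cons, size_frame, size_nil) ?(size_pair b) ?size_nil;
    have := size_bool b; rewrite /=; lia.
- move: (leaf_attribute o) (fun L => HC (leaf_attribute o L)) => lf Hlf.
  rewrite /push_task; case: stk => [|[[b0 l0] v0] [|[[b1 l1] v1] [|[[b2 l2] v2] stk]]];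
    try exact: fail_le.
  case: ifP => _ /=; last exact: fail_le.
  rewrite !(size_state, size_cons, size_frame, size_nil) size_pair.
  by have := Hlf l1; rewrite /=; lia.
- rewrite /push_node; case: stk => [|[[b0 l0] v0] [|[[b1 l1] v1] stk]];
    try exact: fail_le.
  case: ifP => _ /=; last exact: fail_le.
  move: (node_attribute op v0) (HC (node_attribute op v0)) => a Ha.
  by rewrite !(size_state, size_cons, size_frame, size_nil); lia.
- rewrite /push_obligation; case: ifP => //; case: stk => [|[[b0 l0] v0] [|? ?]] //=.
  case: l0 => [|r [|t [|d [|? ?]]]] //=; rewrite ?andbF // => _.
  rewrite !(size_state, size_cons, size_frame, size_nil).
  have E (x : literal) : tree_size (code x) = (tree_size (code x.1) + tree_size (code x.2)).+1.
    exact: size_pair.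
  have := size_obligation k r t d; rewrite !E.
  move: (tree_size (code r.1)) (tree_size (code r.2)) => r1 r2.
  move: (tree_size (code t.1)) (tree_size (code t.2)) => t1 t2.
  by move: (tree_size (code d.1)) (tree_size (code d.2)) => d1 d2; lia.
- rewrite /push_frame; case: ifP => // _ /=;
    rewrite !(size_state, size_cons, size_frame, size_nil); lia.
Qed.

Lemma polytime_parse (X : codedType) (o : X -> obligation) (w : X -> seq symbol) :
  polytime o -> polytime w ->
  polytime (fun x => parse_for (o x) (w x) : parser_state attribute).
Proof.
move=> Ho Hw; have [C HC] := size_parser_step.
pose g (u : X * (symbol * parser_state attribute)) : parser_state attribute :=
  parser_step (leaf_attribute (o u.1)) node_attribute u.2.1 u.2.2.
have Hg : polytime g.
  pose h (a : symbol) (u : X * parser_state attribute) : parser_state attribute :=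
    parser_step (leaf_attribute (o u.1)) node_attribute a u.2.
  (* One program per input symbol, selected by a finite case distinction. *)
  apply: (@polytime_switch _ _ _ _ Close symbols h (fun u => u.2.1) (fun u => (u.1, u.2.2))).
  - exact: covers_symbol.
  - move=> a; apply: polytime_parser_step; last by polytime_tac.
    exact: polytime_comp Ho (@polytime_proj1 _ _).
  - by polytime_tac.
  - by polytime_tac.
apply: (polytime_foldr (r := fun=> C) Hg) => //; first by pol.
  by move=> x a st; apply: HC.
exact: polytime_const.
Qed.

Lemma polytime_obligation_ok (X : codedType) (w : X -> seq symbol)
    (ts : X -> seq (name * seq literal)) (o : X -> obligation) :
  polytime w -> polytime ts -> polytime o ->
  polytime (fun x => obligation_ok (w x) (ts x) (o x)).
Proof.
move=> Hw Hts Ho; rewrite /obligation_ok; polytime_tac.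
- apply: polytime_mem_literal; last by polytime_tac.
  exact: polytime_compl (polytime_requirement Ho).
- apply: polytime_mem_literal; last by polytime_tac.
  exact: polytime_deadline.
- apply: polytime_accepts => //; rewrite /root_attribute.
  have H := polytime_parse Ho Hw.
  by polytime_tac.
Qed.

Lemma polytime_decide : polytime decide.
Proof.
have H := polytime_parse (polytime_const _ obligation0) (polytime_id (seq symbol)).
rewrite /decide /final /root_attribute; polytime_tac.
- apply: polytime_uniq.
  have Hg : polytime (fun u : seq symbol * ((name * seq literal) * seq name) =>
      u.2.1.1 :: u.2.2) by polytime_tac.
  have Hl : polytime (fun w => (parse_for obligation0 w).1.2) by polytime_tac.
  apply: (polytime_foldr (r := fun n => n) Hg pol_id _ (polytime_const _ [::]) Hl).
  by move=> x [y L] z; rewrite size_cons size_pair /=; lia.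
- apply: (@polytime_all _ _ (fun u => consistent u.2.2)); last by polytime_tac.
  by apply: polytime_consistent; polytime_tac.
- have Hl : polytime (fun w => (parse_for obligation0 w).1.1) by polytime_tac.
  apply: (@polytime_all _ _
    (fun u => obligation_ok u.1 (parse_for obligation0 u.1).1.2 u.2)) => //.
  apply: polytime_obligation_ok; try by polytime_tac.
  have Hts : polytime (fun w => (parse_for obligation0 w).1.2) by polytime_tac.
  exact: polytime_comp Hts (@polytime_proj1 _ _).
Qed.

Theorem mainTheorem1 : class_P (language encode admissible fully_compliant).
Proof. exact: class_P_polytime polytime_decide decide_language. Qed.
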